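(* Let $\langle X,\Delta\rangle$ be a pair, and let $f\colon Y\to X$ be a projective birational morphism from a normal variety $Y$. Put $D=\sum_P\alpha(P,X,\Delta)P$, where $P$ runs over all prime divisors on $Y$. Then $$D=K_Y+\bigl(\mathrm{Env}_X(-(K_X+\Delta))\bigr)_Y,$$ where $(\mathrm{Env}_X(-(K_X+\Delta)))_Y$ is the trace on $Y$ of the nef envelope $\mathrm{Env}_X(-(K_X+\Delta))$.
   Context: Varieties are over $\mathbb{C}$. A pair $\langle X,\Delta\rangle$ is a normal variety $X$ with an effective $\mathbb{R}$-divisor $\Delta$; $K_X+\Delta$ need not be $\mathbb{R}$-Cartier. A prime divisor $P$ over $X$ is a prime divisor on a normal variety $Y$ with a projective birational morphism $Y\to X$; $c_X(P)$ denotes its image on $X$, and $v_P$ the corresponding divisorial valuation on $\mathbb{C}(X)$. Canonical divisors are chosen with $f_*K_Y=K_X$. Nef envelope (Boucksom–de Fernex–Favre): for an $\mathbb{R}$-divisor $N$ on $X$, $\mathrm{Env}_X(N)$ is the $\mathbb{R}$-$b$-divisor over $X$ whose coefficient along a prime divisor $P$ over $X$ is $$\sup_{m\ge 1}\Bigl(-\tfrac{1}{m}v_P(\mathcal{O}_X(mN))\Bigr)=\lim_{m\to\infty}\Bigl(-\tfrac{1}{m}v_P(\mathcal{O}_X(mN))\Bigr),$$ where $\mathcal{O}_X(mN)$ is the fractional ideal sheaf of rational functions $\phi$ with $\mathrm{div}(\phi)+mN\ge 0$ (locally), and $v_P(\mathcal{O}_X(mN))$ is the minimum of $v_P(\phi)$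 over $\phi\in\mathcal{O}_X(mN)(U)$, $U\subset X$ open with $U\cap c_X(P)\ne\emptyset$. The trace on $Y$ is $\sum_P(\text{coefficient along }P)\,P$ over prime divisors $P$ on $Y$. Discrepancy $\alpha(P,X,\Delta)$: take $f\colon Y\to X$ projective birational with $Y$ normal and $P$ a prime divisor on $Y$. For an affine open $U\subset X$ with $U\cap c_X(P)\neq\emptyset$ put $V=f^{-1}(U)$, $f_V=f|_V$, $K_U=K_X|_U$, $K_V=K_Y|_V$. For an $\mathbb{R}$-divisor $B_U\ge 0$ on $U$ such that $K_U+\Delta|_U+B_U$ is $\mathbb{R}$-Cartier, put $$\alpha_{\langle X,\Delta\rangle}(P,U,B_U)=\mathrm{coeff}_{P|_V}\bigl(K_V-f_V^*(K_U+\Delta|_U+B_U)\bigr).$$ Then $\alpha(P,X,\Delta):=\sup_{U,B_U}\alpha_{\langle X,\Delta\rangle}(P,U,B_U)$, over all such $U$ and $B_U$ (independent of $f$ and $K_X$). *)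

(* Defs.v *)
From HB Require Import structures.
From mathcomp Require Import all_boot all_order all_algebra.
From mathcomp Require Import complex.
From mathcomp Require Import boolp classical_sets functions cardinality.
From mathcomp Require Import reals constructive_ereal ereal.

Set Implicit Arguments.
Unset Strict Implicit.
Unset Printing Implicit Defensive.
Import Order.TTheory GRing.Theory Num.Theory.
Local Open Scope classical_set_scope.
Local Open Scope ring_scope.

(* Varieties are treated as models of a function field (O. Zariski, P. Samuel,
   Commutative Algebra II, Ch. VI, par. 17; equivalently Chevalley's schemata,
   EGA I, par. 8).  An integral separated scheme X of finite type over k with
   function field K is the set of its local rings O_{X,x}, all of them
   subrings of K; a scheme-theoretic point x is identified with O_{X,x}.
   Birational varieties share the field K, a birational morphism f : Y -> X
   being used to identify K(X) with K(Y).  Subsets of K are of type [set K], so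
   a variety is of type [set (set K)]. *)

Section LocalRings.
Variables (k K : fieldType) (iota : {rmorphism k -> K}).
Implicit Types (A p x y : set K) (s : seq K).

Definition is_subalg A : Prop :=
  [/\ forall c, A (iota c),
      forall a b, A a -> A b -> A (a - b) &
      forall a b, A a -> A b -> A (a * b)].

Definition alg_gen (S : set K) : set K := smallest is_subalg S.

Definition has_fraction_field A : Prop :=
  forall z : K, exists a b, [/\ A a, A b, b != 0 & z = a / b].

Definition is_ideal A p : Prop :=
  [/\ p `<=` A, p 0,
      forall a b, p a -> p b -> p (a + b) &
      forall a b, A a -> p b -> p (a * b)].

Definition is_prime_ideal A p : Prop :=
  [/\ is_ideal A p, ~ p 1 &
      forall a b, A a -> A b -> p (a * b) -> p a \/ p b].

Definition localization A p : set K :=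
  [set z | exists a b, [/\ A a, A b, ~ p b & z = a / b]].

(* the points of Spec A, as local rings in K *)
Definition spec A : set (set K) :=
  [set x | exists2 p, is_prime_ideal A p & x = localization A p].

Definition unit_of x (a : K) : Prop := [/\ a != 0, x a & x a^-1].

Definition max_ideal x : set K := [set a | x a /\ ~ unit_of x a].

Definition dominates y x : Prop := x `<=` y /\ max_ideal x `<=` max_ideal y.

Definition is_valuation_ring (V : set K) : Prop :=
  is_subalg V /\ forall a, a != 0 -> V a \/ V a^-1.

Definition integrally_closed A : Prop :=
  forall (z : K) (q : {poly K}),
    q \is monic -> (forall i, A q`_i) -> root q z -> A z.

(* Krull dimension one of a local domain *)
Definition dim_one x : Prop :=
  max_ideal x <> [set 0] /\
  forall p, is_prime_ideal x p -> p = [set 0] \/ p = max_ideal x.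

(* The valuation of the discrete valuation ring P at a != 0: the n such that
   a = t ^ n * unit, where t generates the maximal ideal; a codimension one
   local ring of a normal variety is such a ring. *)
Definition ord (P : set K) (a : K) : int :=
  xget 0 [set n : int | exists t u,
    [/\ t != 0, max_ideal P = [set t * b | b in P],
        unit_of P u & a = t ^ n * u]].

End LocalRings.

Section Varieties.
Variables (k K : fieldType) (iota : {rmorphism k -> K}).
Implicit Types (X Y U W : set (set K)) (x y P : set K) (s : seq K).

(* Separatedness is the last clause: a valuation ring of K has at most one
   center. *)
Definition is_variety X : Prop :=
  [/\ X !=set0,
      exists charts : seq (seq K),
        (forall s, s \in charts ->
           has_fraction_field (alg_gen iota [set` s])) /\
        X = [set x | exists2 s, s \in charts & spec (alg_gen iota [set` s]) x] &
      forall V x y, is_valuation_ring iota V -> X x -> X y ->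
        dominates V x -> dominates V y -> x = y].

Definition is_normal_variety X : Prop :=
  is_variety X /\ forall x, X x -> integrally_closed x.

(* The Zariski topology of X: the domains of definition of finitely many
   rational functions form a basis. *)
Definition zopen X U : Prop :=
  U `<=` X /\
  forall x, U x -> exists s,
    [set` s] `<=` x /\ [set y | X y /\ [set` s] `<=` y] `<=` U.

Definition affine_open X U : Prop :=
  zopen X U /\ exists s, U = spec (alg_gen iota [set` s]).

Definition zclosure X x : set (set K) :=
  [set z | X z /\ forall W, zopen X W -> W z -> W x].

Definition birational_morphism Y X : Prop :=
  forall y, Y y -> exists2 x, X x & dominates y x.

(* the inverse image of U in Y under the birational morphism Y -> X *)
Definition preimage_open Y U : set (set K) :=
  [set y | Y y /\ exists2 x, U x & dominates y x].

(* nonzero coherent subsheaves J of the constant sheaf K, given by stalks *)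
Definition coherent_fractional_ideal X (J : set K -> set K) : Prop :=
  forall x, X x -> exists W s,
    [/\ zopen X W, W x, exists2 g, g \in s & g != 0 &
        forall z, W z -> J z = [set a | exists b : nat -> K,
          (forall i, z (b i)) /\ a = \sum_(i < size s) b i * s`_i]].

(* The points of Proj (\bigoplus_n J_x^n) above x: the chart of g in J_x is
   the spectrum of the algebra generated over x by the quotients h / g. *)
Definition proj_fibre x (Jx : set K) : set (set K) :=
  [set y | dominates y x /\ exists g, [/\ Jx g, g != 0 &
     spec (alg_gen iota (x `|` [set h / g | h in Jx])) y]].

(* Projectivity: Y = Proj_X S for a graded O_X-algebra S generated by a
   coherent S_1.  As Y is integral and birational to X, S may be taken to be
   generated by the image of S_1 at the generic point, a fractional ideal.
   Closed subvarieties of P^n_X correspond to J generated by n + 1 global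
   rational functions. *)
Definition projective_birational Y X : Prop :=
  birational_morphism Y X /\
  exists2 J, coherent_fractional_ideal X J &
    Y = [set y | exists2 x, X x & proj_fibre x (J x) y].

(* A prime divisor is identified with its generic point. *)
Definition prime_divisor X : set (set K) := [set P | X P /\ dim_one P].

(* c_X(P), the closure of the image of the generic point of P *)
Definition center X P : set (set K) :=
  [set z | exists x, [/\ X x, dominates P x & zclosure X x z]].

End Varieties.

(* Rational differential forms of top degree and canonical divisors.
   Omega_{K/k} is identified with the K-dual of Der_k(K, K), and an n-form with
   a function of n derivations. *)
Section Canonical.
Variables (k K : fieldType) (iota : {rmorphism k -> K}).

Definition is_derivation (D : K -> K) : Prop :=
  [/\ forall c, D (iota c) = 0,
      forall a b, D (a + b) = D a + D b &
      forall a b, D (a * b) = a * D b + b * D a].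

(* d z_1, ..., d z_n is a K-basis of Omega_{K/k}; here n = dim X *)
Definition differential_basis n (z : 'I_n -> K) : Prop :=
  forall c : 'I_n -> K, exists! D, is_derivation D /\ forall i, D (z i) = c i.

(* d z_1 /\ ... /\ d z_n *)
Definition wedge n (z : 'I_n -> K) (D : 'I_n -> K -> K) : K :=
  \det (\matrix_(i < n, j < n) D i (z j)).

Definition form_eq n (w1 w2 : ('I_n -> K -> K) -> K) : Prop :=
  forall D, (forall i, is_derivation (D i)) -> w1 D = w2 D.

Definition nonzero_top_form n (w : ('I_n -> K -> K) -> K) : Prop :=
  exists g z, [/\ g != 0, differential_basis z &
    form_eq w (fun D => g * wedge z D)].

(* d z_1 /\ ... /\ d z_n generates the P-module spanned by the d y_1 /\ ... /\
   d y_n with y_i in P, that is Omega^n_{P/k}, which is free of rank one at a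
   codimension one point P of a normal variety *)
Definition generates_forms (P : set K) n (z : 'I_n -> K) : Prop :=
  (forall i, P (z i)) /\
  forall y : 'I_n -> K, (forall i, P (y i)) ->
    exists2 a, P a & form_eq (wedge y) (fun D => a * wedge z D).

Definition form_order (P : set K) n (w : ('I_n -> K -> K) -> K) (m : int) :
    Prop :=
  exists z b, [/\ generates_forms P z, b != 0,
    form_eq w (fun D => b * wedge z D) & ord P b = m].

End Canonical.

(* Divisors on X are functions on the set of prime divisors of X, extended by
   zero.  As X is noetherian, locally finite sums are finite. *)
Section Divisors.
Variables (R : realType) (k K : fieldType) (iota : {rmorphism k -> K}).
Implicit Types (X Y U W : set (set K)) (x P Q : set K).
Implicit Types (D E N B : set K -> R).

Definition is_divisor X D : Prop :=
  finite_set [set P | D P != 0] /\ [set P | D P != 0] `<=` prime_divisor X.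

Definition effective D : Prop := forall P, 0 <= D P.

Definition restr U D : set K -> R := patch (fun=> 0) U D.

(* f_* D for a projective birational f : Y -> X: a prime divisor P of X has the
   same local ring as its strict transform on Y, and the prime divisors of Y
   that are not strict transforms are contracted. *)
Definition pushforward X D : set K -> R := patch (fun=> 0) (prime_divisor X) D.

Definition div_fun X (phi : K) : set K -> R :=
  patch (fun=> 0) (prime_divisor X) (fun P => (ord P phi)%:~R).

Definition canonical_divisor X D : Prop :=
  is_divisor X D /\
  exists n (w : ('I_n -> K -> K) -> K), nonzero_top_form iota w /\
    forall P, prime_divisor X P ->
      exists2 m : int, form_order iota P w m & D P = m%:~R.

Definition local_equation X E x (phi : K) : Prop :=
  phi != 0 /\ exists W, [/\ zopen X W, W x & restr W E = div_fun W phi].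

Definition cartier X E : Prop :=
  is_divisor X E /\ forall x, X x -> exists phi, local_equation X E x phi.

Definition cartier_decomposition X E n (r : 'I_n -> R)
    (F : 'I_n -> set K -> R) : Prop :=
  (forall i, cartier X (F i)) /\
  E = (fun Q => \sum_(i < n) r i * F i Q).

Definition R_cartier X E : Prop :=
  exists n (r : 'I_n -> R) F, cartier_decomposition X E r F.

(* The coefficient along P of the pullback of an R-Cartier divisor
   E = \sum_i r_i F_i on X: \sum_i r_i v_P(phi_i), where phi_i is an equation
   of F_i at the image x of the generic point of P.  On a normal variety it
   does not depend on the choices. *)
Definition pullback_coeff X E P : R :=
  xget 0 [set c | exists n (r : 'I_n -> R) F (phi : 'I_n -> K) x,
    [/\ cartier_decomposition X E r F, X x, dominates P x,
        forall i, local_equation X (F i) x (phi i) &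
        c = \sum_(i < n) r i * (ord P (phi i))%:~R]].

(* alpha_{<X, Delta>}(P, U, B) *)
Definition discrepancy_on Y KX KY Delta P U B : R :=
  restr (preimage_open Y U) KY P -
  pullback_coeff U (fun Q => restr U KX Q + restr U Delta Q + B Q) P.

(* alpha(P, X, Delta), computed on Y *)
Definition discrepancy X Y KX KY Delta P : \bar R :=
  ereal_sup [set a | exists U B,
    [/\ affine_open iota X U, U `&` center X P !=set0,
        is_divisor U B, effective B /\
        R_cartier U (fun Q => restr U KX Q + restr U Delta Q + B Q) &
        a = (discrepancy_on Y KX KY Delta P U B)%:E]].

(* the sections over U of the fractional ideal sheaf O_X(N) *)
Definition divisorial_sections N U : set K :=
  [set phi | phi = 0 \/
     forall Q, prime_divisor U Q -> 0 <= (ord Q phi)%:~R + N Q].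

(* v_P(O_X(N)), as an infimum; zero sections are left out, having valuation
   +oo *)
Definition ord_divisorial X N P : \bar R :=
  ereal_inf [set a | exists U phi,
    [/\ zopen X U, U `&` center X P !=set0,
        divisorial_sections N U phi, phi != 0 & a = ((ord P phi)%:~R)%:E]].

(* the coefficient along P of Env_X(N) *)
Definition env_coeff X N P : \bar R :=
  ereal_sup [set a | exists2 m : nat, (0 < m)%N &
    a = ((- m%:R^-1)%:E * ord_divisorial X (fun Q => m%:R * N Q)%R P)%E].

(* D is the R-divisor \sum_P c_P P on Y, the sum being over all prime divisors
   of Y; in particular the c_P are finite and almost all zero. *)
Definition is_divisor_sum Y (c : set K -> \bar R) D : Prop :=
  is_divisor Y D /\ forall P, prime_divisor Y P -> c P = (D P)%:E.

End Divisors.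

(* Main.v *)
(* Put N = - (K_X + Delta) and let x be the image on X of the generic point of
   P.  Near x, a section phi of O_X(mN) is the same as an effective B such that
   K_X + Delta + B = (1/m) div phi, and then the coefficient of the pullback
   along P is v_P(phi) / m; this gives >= in
   alpha(P) = coeff_P K_Y + coeff_P Env_X(N).  Conversely, an R-Cartier divisor
   K_X + Delta + B is \sum_i r_i div psi_i near x.  Rounding m r_i down, and
   multiplying by a fixed h in O_{X,x} whose divisor absorbs the rounding errors
   at all points of codimension one at once, yields sections
   phi_m = h \prod_i psi_i ^ (floor (m r_i)) of O_X(mN) with
   v_P(phi_m) <= m \sum_i r_i v_P(psi_i) + C.  The same rounding, together with
   the fact that a function regular in codimension one is regular, shows that
   pullback coefficients do not depend on the choices.
   For finiteness, cover X by charts Spec A and take h in A, nonzero, with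
   div h >= |N| on Spec A: then |coeff_P Env_X(N)| <= v_P(h) if x is in Spec A,
   and v_P(h) vanishes for almost all P on Y. *)

Require Import Defs.
From mathcomp Require Import all_boot all_order all_algebra.
From mathcomp Require Import complex.
From mathcomp Require Import boolp classical_sets functions cardinality.
From mathcomp Require Import reals constructive_ereal ereal.
Local Open Scope classical_set_scope.
Local Open Scope ring_scope.
Set Implicit Arguments.
Unset Strict Implicit.
Unset Printing Implicit Defensive.
Import Order.TTheory GRing.Theory Num.Theory.

(** A variety being a bare set of subrings of [K], two facts of commutative algebra carry the
    argument and are proved for such subrings: finitely generated algebras are noetherian, and a
    normal noetherian local domain is the intersection of its localizations that are discrete
    valuation rings. Separatedness enters through valuation rings: it makes the point [x] below [P]
    unique, so that the varying open sets in both suprema become neighbourhoods of one point. Both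
    suprema are then compared with one set of reals, the numbers -v_P(phi) / m for nonzero germs phi
    at [x] of sections of O_X(mN). The obstacle is the limit in m. The rounded sections must live on
    one neighbourhood of [x] and have bounded error at [P], uniformly in m; this is why h is built
    from numerators and denominators of the psi_i, which control every valuation ring containing
    them, [P] included. As [pullback_coeff] selects an unknown decomposition, independence of the
    choices enters as an inequality for multiples of a principal divisor, which suffices because
    alpha is a supremum. *)

(** * Noetherian subrings of a field and Hilbert's basis theorem *)

Section NoetherianSubrings.
Variables (k K : fieldType) (iota : {rmorphism k -> K}).
Implicit Types (A I : set K) (a b c t z : K) (s : seq K) (p q : {poly K}).

Lemma subalg_scalar A (c : k) : is_subalg iota A -> A (iota c).
Proof. by case. Qed.

Lemma subalgB A a b : is_subalg iota A -> A a -> A b -> A (a - b).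
Proof. by case=> _ + _; apply. Qed.

Lemma subalgM A a b : is_subalg iota A -> A a -> A b -> A (a * b).
Proof. by case=> _ _; apply. Qed.

Lemma subalg0 A : is_subalg iota A -> A 0.
Proof. by move=> hA; rewrite -(rmorph0 iota); apply: subalg_scalar. Qed.

Lemma subalg1 A : is_subalg iota A -> A 1.
Proof. by move=> hA; rewrite -(rmorph1 iota); apply: subalg_scalar. Qed.

Lemma subalgN A a : is_subalg iota A -> A a -> A (- a).
Proof. by move=> hA Aa; rewrite -sub0r; apply: subalgB => //; apply: subalg0. Qed.

Lemma subalgD A a b : is_subalg iota A -> A a -> A b -> A (a + b).
Proof. by move=> hA Aa Ab; rewrite -(opprK b); apply: subalgB => //; apply: subalgN. Qed.

Lemma subalgX A a n : is_subalg iota A -> A a -> A (a ^+ n).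
Proof.
move=> hA Aa; elim: n => [|n IH]; first exact: subalg1.
by rewrite exprS; apply: subalgM.
Qed.

Lemma subalg_sum A (J : Type) (r : seq J) (P : pred J) (F : J -> K) :
  is_subalg iota A -> (forall i, P i -> A (F i)) -> A (\sum_(i <- r | P i) F i).
Proof.
move=> hA AF; elim/big_ind: _ => //; first exact: subalg0.
by move=> a b; apply: subalgD.
Qed.

Lemma idealB A I a b : is_subalg iota A -> is_ideal A I -> I a -> I b -> I (a - b).
Proof.
move=> hA [_ _ ID IM] Ia Ib; apply: ID => //; rewrite -mulN1r.
by apply: IM => //; apply: subalgN => //; apply: subalg1.
Qed.

Lemma ideal_sum A I (J : Type) (r : seq J) (P : pred J) (F : J -> K) :
  is_ideal A I -> (forall i, P i -> I (F i)) -> I (\sum_(i <- r | P i) F i).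
Proof.
by move=> [_ I0 ID _] IF; elim/big_ind: _ => //; apply: ID.
Qed.

Lemma prime_ideal_sub A I : is_prime_ideal A I -> I `<=` A.
Proof. by move=> [[]]. Qed.

Definition ideal_gen A (S : set K) : set K := smallest (is_ideal A) S.

Lemma ideal_self A : is_subalg iota A -> is_ideal A A.
Proof.
move=> hA; split=> //; first exact: subalg0.
  by move=> a b; apply: subalgD.
by move=> a b; apply: subalgM.
Qed.

Lemma ideal_gen_ideal A (S : set K) : is_subalg iota A -> S `<=` A ->
  is_ideal A (ideal_gen A S).
Proof.
move=> hA SA; split=> [a||a b ga gb J hJ|a b Aa gb J hJ].
- by apply; split=> //; apply: ideal_self.
- by move=> J [[_ J0 _ _] _].
- by have [[_ _ JD _] _] := hJ; apply: JD; [apply: ga|apply: gb].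
- by have [[_ _ _ JM] _] := hJ; apply: JM => //; apply: gb.
Qed.

Definition noetherian A : Prop :=
  forall I, is_ideal A I -> exists s, I = ideal_gen A [set` s].

Lemma chain_leq (I : nat -> set K) m n : (forall n, I n `<=` I n.+1) ->
  (m <= n)%N -> I m `<=` I n.
Proof.
move=> Iinc; elim: n => [|n IH]; first by rewrite leqn0 => /eqP ->.
rewrite leq_eqVlt => /orP[/eqP -> //|]; rewrite ltnS => /IH.
by move=> h a /h; apply: Iinc.
Qed.

Lemma noetherian_chain A (I : nat -> set K) : noetherian A ->
  (forall n, is_ideal A (I n)) -> (forall n, I n `<=` I n.+1) ->
  exists N, forall n, I n `<=` I N.
Proof.
move=> nA hI Iinc; have Ile m n := @chain_leq I m n Iinc.
pose J := [set a | exists n, I n a].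
have hJ : is_ideal A J.
  split=> [a [n]||a b [n In] [m Im]|a b Aa [n In]].
  - by case: (hI n) => h _ _ _; apply: h.
  - by exists 0%N; case: (hI 0%N).
  - exists (maxn n m); case: (hI (maxn n m)) => _ _ ID _.
    by apply: ID; [apply: Ile In|apply: Ile Im]; rewrite ?leq_maxl ?leq_maxr.
  - by exists n; case: (hI n) => _ _ _; apply.
have [s Js] := nA _ hJ.
have [N sN] : exists N, [set` s] `<=` I N.
  have : forall a, a \in s -> J a by move=> a sa; rewrite Js; apply: sub_gen_smallest.
  elim: (s) => [|a l IH] h; first by exists 0%N.
  have [N hN] := IH (fun b lb => h b (@mem_behead _ (a :: l) b lb)).
  have [m hm] := h a (mem_head _ _).
  exists (maxn N m) => b /=; rewrite inE => /orP[/eqP ->|lb].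
    by apply: Ile hm; rewrite leq_maxr.
  by apply: (Ile N); rewrite ?leq_maxl //; apply: hN.
exists N => n a Ina; suff: J `<=` I N by apply; exists n.
by rewrite Js; apply: smallest_sub.
Qed.

Lemma noetherian_max A (F : set (set K)) : noetherian A -> F !=set0 ->
  (forall I, F I -> is_ideal A I) ->
  exists2 I, F I & forall J, F J -> I `<=` J -> J `<=` I.
Proof.
move=> nA [I0 FI0] Fid; apply: contrapT => hno.
have /choice [next hnext] : forall I, exists J, F I -> [/\ F J, I `<=` J & ~ J `<=` I].
  move=> I; case: (pselect (F I)) => FI; last by exists I.
  apply: contrapT => hI; apply: hno; exists I => // J FJ IJ.
  by apply: contrapT => JI; apply: hI; exists J.
pose c n := iter n next I0.
have cF n : F (c n) by elim: n => //= n IH; case: (hnext _ IH).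
have [|n|N hN] := @noetherian_chain A c nA; first by move=> n; apply: Fid.
  by case: (hnext _ (cF n)).
by case: (hnext _ (cF N)) => _ _ []; apply: (hN N.+1).
Qed.

(** [A] is a set in [K] and not a ring type, so the polynomial ring over [A] is carved out of
    [{poly K}]. *)
Definition coefs_in A q : Prop := forall i, A q`_i.

Lemma coefs_inC A c : is_subalg iota A -> A c -> coefs_in A c%:P.
Proof. by move=> hA Ac i; rewrite coefC; case: eqP => // _; apply: subalg0. Qed.

Lemma coefs_inX A n : is_subalg iota A -> coefs_in A 'X^n.
Proof.
by move=> hA i; rewrite coefXn; case: eqP => _; [apply: subalg1|apply: subalg0].
Qed.

Lemma coefs_inB A p q : is_subalg iota A -> coefs_in A p -> coefs_in A q ->
  coefs_in A (p - q).
Proof. by move=> hA hp hq i; rewrite coefB; apply: subalgB. Qed.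

Lemma coefs_inD A p q : is_subalg iota A -> coefs_in A p -> coefs_in A q ->
  coefs_in A (p + q).
Proof. by move=> hA hp hq i; rewrite coefD; apply: subalgD. Qed.

Lemma coefs_inM A p q : is_subalg iota A -> coefs_in A p -> coefs_in A q ->
  coefs_in A (p * q).
Proof.
by move=> hA hp hq i; rewrite coefM; apply: subalg_sum => // j _; apply: subalgM.
Qed.

Definition adjoin A t : set K := [set z | exists2 q, coefs_in A q & z = q.[t]].

Lemma adjoin_subalg A t : is_subalg iota A -> is_subalg iota (adjoin A t).
Proof.
move=> hA; split=> [c|_ _ [p hp ->] [q hq ->]|_ _ [p hp ->] [q hq ->]].
- by exists (iota c)%:P; rewrite ?hornerC //; apply: coefs_inC => //; apply: subalg_scalar.
- by exists (p - q); rewrite ?hornerE //; apply: coefs_inB.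
- by exists (p * q); rewrite ?hornerM //; apply: coefs_inM.
Qed.

Lemma sub_adjoin A t : is_subalg iota A -> A `<=` adjoin A t.
Proof. by move=> hA c Ac; exists c%:P; rewrite ?hornerC //; apply: coefs_inC. Qed.

Lemma adjoin_gen A t : is_subalg iota A -> adjoin A t t.
Proof.
move=> hA; exists 'X; rewrite ?hornerX // -['X]expr1; exact: coefs_inX.
Qed.

Lemma adjoin_sub A B t : is_subalg iota B -> A `<=` B -> B t -> adjoin A t `<=` B.
Proof.
move=> hB AB Bt _ [q hq ->]; rewrite horner_coef; apply: subalg_sum => // i _.
by apply: subalgM => //; [apply/AB/hq|apply: subalgX].
Qed.

Lemma alg_gen_subalg (S : set K) : is_subalg iota (alg_gen iota S).
Proof.
split=> [c B [[]] //|a b ga gb B [hB SB]|a b ga gb B [hB SB]].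
  by apply: subalgB => //; [apply: ga|apply: gb].
by apply: subalgM => //; [apply: ga|apply: gb].
Qed.

Lemma alg_gen_cons a s :
  alg_gen iota [set` a :: s] = adjoin (alg_gen iota [set` s]) a.
Proof.
have hs := alg_gen_subalg [set` s]; rewrite eqEsubset; split.
  apply: smallest_sub; first exact: adjoin_subalg.
  move=> b /=; rewrite inE => /orP[/eqP ->|sb]; first exact: adjoin_gen.
  by apply: sub_adjoin => //; apply: sub_gen_smallest.
apply: adjoin_sub; first exact: alg_gen_subalg.
  apply: smallest_sub; first exact: alg_gen_subalg.
  by move=> b sb; apply: sub_gen_smallest => /=; rewrite inE sb orbT.
by apply: sub_gen_smallest => /=; apply: mem_head.
Qed.

(* Hilbert's basis theorem: if the ideal I of A[t] is not finitely generated,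
   choose successively polynomials p_n of minimal degree whose values at t lie
   in I, but not in the ideal generated by the preceding values.  By the chain
   condition some leading coefficient of p_N lies in the ideal generated by the
   preceding ones, and the degree of p_N can be lowered. *)
Lemma noetherian_adjoin A t : is_subalg iota A -> noetherian A ->
  noetherian (adjoin A t).
Proof.
move=> hA nA I hI; have hB := adjoin_subalg t hA.
apply: contrapT => hno; have [IB I0 ID IM] := hI.
pose ev (l : seq {poly K}) := [seq q.[t] | q : {poly K} <- l].
pose good q := coefs_in A q /\ I q.[t].
pose gens l := ideal_gen (adjoin A t) [set` ev l].
have /choice [next hnext] : forall l, exists p, (forall q, q \in l -> good q) ->
    [/\ good p, ~ gens l p.[t] &
        forall q, good q -> ~ gens l q.[t] -> (size p <= size q)%N].
  move=> l; case: (pselect (forall q, q \in l -> good q)) => hl; last by exists 0.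
  have gI : gens l `<=` I.
    by apply: smallest_sub => // b /= /mapP[q /hl [_ Iq] ->].
  have [q0 gq0 nq0] : exists2 q, good q & ~ gens l q.[t].
    apply: contrapT => h; apply: hno; exists (ev l); rewrite eqEsubset; split=> // z Iz.
    apply: contrapT => nz; have [q Aq zq] := IB _ Iz; apply: h.
    by exists q; rewrite -?zq //; split=> //; rewrite -zq.
  pose Q n := `[< exists q, [/\ good q, ~ gens l q.[t] & size q = n] >].
  have exQ : exists n, Q n by exists (size q0); apply/asboolP; exists q0.
  have [n /asboolP [p [gp np <-]] hmin] := ex_minnP exQ.
  exists p => _; split=> // q gq nq; apply: hmin; apply/asboolP; exists q.
  by [].
pose l n := iter n (fun l => next l :: l) [::].
pose p n := next (l n).
have lS n : l n.+1 = p n :: l n by [].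
have hl n : forall q, q \in l n -> good q.
  elim: n => // n IH q; rewrite lS inE => /orP[/eqP ->|]; last exact: IH.
  by case: (hnext _ IH).
have pgood n : good (p n) by case: (hnext _ (hl n)).
have pgens n : ~ gens (l n) (p n).[t] by case: (hnext _ (hl n)).
have pmin n q : good q -> ~ gens (l n) q.[t] -> (size (p n) <= size q)%N.
  by case: (hnext _ (hl n)) => _ _; apply.
have evB n : [set` ev (l n)] `<=` adjoin A t.
  by move=> z /= /mapP[q /hl[Aq _] ->]; exists q.
have gI n : is_ideal (adjoin A t) (gens (l n)) by apply: ideal_gen_ideal.
have ginc m n : (m <= n)%N -> gens (l m) `<=` gens (l n).
  apply: (@chain_leq (fun n => gens (l n))) => {m}n.
  apply: sub_smallest2r; first exact: gI.
  by move=> z /mapP[q lq ->]; apply/mapP; exists q; rewrite // lS inE lq orbT.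
have gp m n : (m < n)%N -> gens (l n) (p m).[t].
  move=> mn; apply: (ginc _ _ mn); apply: sub_gen_smallest.
  by apply/mapP; exists (p m); rewrite // lS mem_head.
have sp m n : (m <= n)%N -> (size (p m) <= size (p n))%N.
  by move=> mn; apply: pmin => // /(ginc _ _ mn); apply: pgens.
have p0 n : p n != 0.
  by apply/eqP => pn0; apply: (pgens n); rewrite pn0 horner0; case: (gI n).
pose lc n := lead_coef (p n).
have Alc n : A (lc n) by apply: (pgood n).1.
pose L n := ideal_gen A [set z | exists2 i, (i < n)%N & z = lc i].
have LA n : [set z | exists2 i, (i < n)%N & z = lc i] `<=` A by move=> z [i _ ->].
have [n|n|N hN] := @noetherian_chain A L nA.
- exact: ideal_gen_ideal.
- apply: sub_smallest2r; first exact: ideal_gen_ideal.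
  by move=> z [i lt_in ->]; exists i; rewrite // ltnW.
(* Reading the coefficient at the index of the leading term of [p N], which is zero when [q] is
   shorter, makes these coefficients an ideal of [A]; it contains the earlier leading
   coefficients. *)
pose C := [set c | A c /\ exists q, [/\ coefs_in A q, gens (l N) q.[t],
  (size q <= size (p N))%N & q`_(size (p N)).-1 = c]].
have hC : is_ideal A C.
  have [gB g0 gD gM] := gI N; split=> [c []//||a b|a b Aa].
  - split; first exact: subalg0.
    exists 0; split; rewrite ?horner0 ?size_poly0 ?coef0 // => i.
    by rewrite coef0; apply: subalg0.
  - case=> Aa [q [Aq gq sq qa]] [Ab [r [Ar gr sr rb]]]; split; first exact: subalgD.
    exists (q + r); split; rewrite ?hornerD ?coefD ?qa ?rb //.
    + exact: coefs_inD.
    + exact: gD.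
    + by rewrite (leq_trans (size_polyD _ _)) // geq_max sq.
  - case=> Ab [r [Ar gr sr rb]]; split; first exact: subalgM.
    exists (a%:P * r); split; rewrite ?hornerM ?hornerC ?coefCM ?rb //.
    + by apply: coefs_inM => //; apply: coefs_inC.
    + by apply: gM => //; apply: sub_adjoin.
    + by rewrite mul_polyC (leq_trans (size_scale_leq _ _)).
have : C (lc N).
  suff : L N `<=` C by apply; apply: (hN N.+1); apply: sub_gen_smallest; exists N.
  apply: smallest_sub => // z [i iN ->]; split=> //.
  have [Ap _] := pgood i; have [_ _ _ gM] := gI N.
  have spi := sp _ _ (ltnW iN); have pi0 := p0 i.
  (* The exponent is a genuine difference: by the minimal choice, sizes never decrease along the
     sequence ([sp]). *)
  exists (p i * 'X^(size (p N) - size (p i))); split.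
  - by apply: coefs_inM => //; apply: coefs_inX.
  - rewrite hornerM mulrC hornerXn; apply: gM; last exact: gp.
    by apply: subalgX => //; apply: adjoin_gen.
  - by rewrite (leq_trans (size_polyMleq _ _)) // size_polyXn addnS /= subnKC.
  - rewrite coefMXn ltnNge.
    have -> : (size (p N) - size (p i) <= (size (p N)).-1)%N.
      by rewrite -subn1 leq_sub2l // size_poly_gt0.
    rewrite /lc lead_coefE; congr (_`_ _).
    by rewrite -!subn1 subnAC subKn.
case=> _ [q [Aq gq sq qlc]].
have [AN IN] := pgood N; have [gB g0 gD gM] := gI N.
have IgN : gens (l N) `<=` I.
  by apply: smallest_sub => // b /= /mapP[r /hl [_ Ir] ->].
have nr : ~ gens (l N) (p N - q).[t].
  by rewrite hornerD hornerN => h; apply: (pgens N); rewrite -(subrK q.[t] (p N).[t]); apply: gD.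
have gr : good (p N - q).
  split; first exact: coefs_inB.
  by rewrite hornerD hornerN; apply: idealB hB hI _ _ => //; apply: IgN.
have := pmin N _ gr nr; rewrite leqNgt => /negP; apply.
have s0 : (0 < size (p N))%N by rewrite size_poly_gt0.
rewrite -(prednK s0) ltnS; apply/leq_sizeP => j.
rewrite leq_eqVlt => /orP[/eqP <-|]; first by rewrite coefB qlc /lc lead_coefE subrr.
rewrite -subn1 ltn_subLR // addnC addn1 ltnS => hj.
by rewrite coefB !nth_default ?subrr // (leq_trans sq).
Qed.

Lemma noetherian_field A : is_subalg iota A -> (forall a, A a -> a != 0 -> A a^-1) ->
  noetherian A.
Proof.
move=> hA AV I hI; have [IA I0 ID IM] := hI.
case: (pselect (exists2 c, I c & c != 0)) => [[c Ic c0]|hno]; last first.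
  exists [::]; rewrite eqEsubset; split=> [z Iz|]; last exact: smallest_sub.
  have -> : z = 0 by apply: contrapT => /eqP z0; apply: hno; exists z.
  by move=> J [[_ J0 _ _] _].
exists [:: c]; rewrite eqEsubset; split=> [z Iz J [[_ _ _ JM] cJ]|].
  rewrite -(divfK c0 z); apply: JM; last by apply: cJ; rewrite /= inE.
  by apply: subalgM => //; [apply: IA|apply: AV => //; apply: IA].
by apply: smallest_sub => // z /=; rewrite inE => /eqP ->.
Qed.

Lemma noetherian_alg_gen s : noetherian (alg_gen iota [set` s]).
Proof.
elim: s => [|a s IH]; last first.
  by rewrite alg_gen_cons; apply: noetherian_adjoin => //; apply: alg_gen_subalg.
have hr : is_subalg iota (range iota).
  split=> [c|_ _ [a _ <-] [b _ <-]|_ _ [a _ <-] [b _ <-]]; first by exists c.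
    by exists (a - b); rewrite ?rmorphB.
  by exists (a * b); rewrite ?rmorphM.
have -> : alg_gen iota [set` [::]] = range iota.
  rewrite eqEsubset; split; first exact: smallest_sub.
  by move=> _ [c _ <-]; apply: subalg_scalar; apply: alg_gen_subalg.
apply: noetherian_field => // _ [c _ <-] _; exists c^-1 => //.
by rewrite fmorphV.
Qed.

End NoetherianSubrings.

(** * Local rings, localizations and associated primes *)

Section LocalRings.
Variables (k K : fieldType) (iota : {rmorphism k -> K}).
Implicit Types (A B I x y : set K) (a b c t z : K) (s : seq K).

Lemma unit_ofM A a b : is_subalg iota A -> unit_of A a -> unit_of A b ->
  unit_of A (a * b).
Proof.
move=> hA [a0 Aa Aa'] [b0 Ab Ab']; split; first exact: mulf_neq0.
  exact: (subalgM hA).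
by rewrite invfM; apply: (subalgM hA).
Qed.

Lemma unit_ofV A a : unit_of A a -> unit_of A a^-1.
Proof. by case=> a0 Aa Aa'; split; rewrite ?invr_eq0 ?invrK. Qed.

Lemma unit_ofXz A a (n : int) : is_subalg iota A -> unit_of A a -> unit_of A (a ^ n).
Proof.
move=> hA ua.
have uX m : unit_of A (a ^+ m).
  elim: m => [|m IH]; last by rewrite exprS; apply: (unit_ofM hA).
  by rewrite expr0; split; rewrite ?oner_eq0 ?invr1 //; apply: subalg1 hA.
case: n => n; first exact: uX.
by rewrite NegzE -exprnN; apply: unit_ofV; apply: uX.
Qed.

Definition is_local x : Prop := is_subalg iota x /\ is_ideal x (max_ideal x).

Lemma max_ideal1 x : is_subalg iota x -> ~ max_ideal x 1.
Proof.
move=> hx [_]; apply; split; rewrite ?oner_eq0 ?invr1 //; exact: subalg1 hx.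
Qed.

Lemma max_ideal0 x : is_subalg iota x -> max_ideal x 0.
Proof. by move=> hx; split; [apply: subalg0 hx | case; rewrite eqxx]. Qed.

Lemma unit_not_max x a : unit_of x a -> ~ max_ideal x a.
Proof. by move=> ua []. Qed.

Lemma not_max_unit x a : x a -> ~ max_ideal x a -> unit_of x a.
Proof. by move=> xa h; apply: contrapT => h'; apply: h. Qed.

Lemma max_ideal_prime x : is_local x -> is_prime_ideal x (max_ideal x).
Proof.
move=> [hx hm]; split=> //; first exact: max_ideal1.
move=> a b xa xb mab; apply: contrapT => /not_orP[na nb].
apply: (unit_not_max _ mab); apply: (unit_ofM hx); exact: not_max_unit.
Qed.

Lemma dominates_trans x y V : dominates V y -> dominates y x -> dominates V x.
Proof.
move=> [yV mV] [xy my]; split; [exact: subset_trans yV|exact: subset_trans mV].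
Qed.

Section Localization.
Variables A p : set K.
Hypotheses (hA : is_subalg iota A) (hp : is_prime_ideal A p).
Let S := localization A p.

Lemma compl_prime_neq0 b : ~ p b -> b != 0.
Proof. by move=> pb; apply/eqP => b0; apply: pb; rewrite b0; case: hp => [[]]. Qed.

Lemma compl_primeM a b : A a -> A b -> ~ p a -> ~ p b -> ~ p (a * b).
Proof. by case: hp => _ _ h Aa Ab pa pb /h; case. Qed.

Lemma sub_localization : A `<=` S.
Proof.
move=> a Aa; exists a, 1; rewrite divr1; split=> //; first exact: subalg1 hA.
by case: hp.
Qed.

Lemma localization_inv b : A b -> ~ p b -> S b^-1.
Proof.
by move=> Ab pb; exists 1, b; rewrite div1r; split=> //; apply: subalg1 hA.
Qed.

Lemma localization_subalg : is_subalg iota S.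
Proof.
split=> [c|_ _ [a [b [Aa Ab pb ->]]] [c [d [Ac Ad pd ->]]]
          |_ _ [a [b [Aa Ab pb ->]]] [c [d [Ac Ad pd ->]]]].
- by apply: sub_localization; apply: subalg_scalar hA.
- exists (a * d - c * b), (b * d); split.
  + by apply: (subalgB hA); apply: (subalgM hA).
  + exact: (subalgM hA).
  + exact: compl_primeM.
  + by rewrite -mulNr addf_div ?compl_prime_neq0 // mulNr.
- exists (a * c), (b * d); split; try exact: (subalgM hA).
    exact: compl_primeM.
  by rewrite mulf_div.
Qed.

Lemma localization_max :
  max_ideal S = [set z | exists a b, [/\ p a, A b, ~ p b & z = a / b]].
Proof.
have pA := prime_ideal_sub hp.
rewrite eqEsubset; split=> [_ [[a [b [Aa Ab pb ->]]] nu]|_ [a [b [pa Ab pb ->]]]].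
  exists a, b; split=> //; apply: contrapT => pa; apply: nu.
  have [a0 b0] := (compl_prime_neq0 pa, compl_prime_neq0 pb).
  split; first by rewrite mulf_neq0 ?invr_eq0.
    by exists a, b.
  by rewrite invf_div; exists b, a.
split; first by exists a, b; split=> //; apply: pA.
case=> ab0 _ [c [d [Ac Ad pd]]] /eqP; rewrite invf_div.
have a0 : a != 0 by apply: contra_neq ab0 => ->; rewrite mul0r.
rewrite eqr_div ?(compl_prime_neq0 pd) // => /eqP h.
apply: (compl_primeM Ab Ad pb pd); rewrite h mulrC.
by case: hp => [[_ _ _ pM]] _ _; rewrite mulrC; apply: pM.
Qed.

Lemma localization_maxA : max_ideal S `&` A = p.
Proof.
have pA := prime_ideal_sub hp.
rewrite localization_max eqEsubset; split=> [z [[a [b [pa Ab pb zab]]] Az]|z pz].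
  have b0 := compl_prime_neq0 pb.
  have : p (z * b) by rewrite zab divfK.
  by case: hp => _ _ h /h; case.
split; last exact: pA.
exists z, 1; rewrite divr1; split=> //; first exact: subalg1 hA.
by case: hp.
Qed.

Lemma localization_local : is_local S.
Proof.
have hS := localization_subalg; split=> //.
have pA := prime_ideal_sub hp; have [[_ p0 pD pM] p1 _] := hp.
split=> [z []||a b|a b] //; first exact: max_ideal0.
  rewrite localization_max => -[a1 [b1 [pa1 Ab1 pb1 ->]]] [a2 [b2 [pa2 Ab2 pb2 ->]]].
  exists (a1 * b2 + a2 * b1), (b1 * b2); split.
  - by rewrite [a1 * _]mulrC [a2 * _]mulrC; apply: pD; apply: pM.
  - exact: (subalgM hA).
  - exact: compl_primeM.
  - by rewrite addf_div ?compl_prime_neq0.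
rewrite localization_max => -[a1 [b1 [Aa1 Ab1 pb1 ->]]] [a2 [b2 [pa2 Ab2 pb2 ->]]].
exists (a1 * a2), (b1 * b2); split; first exact: pM.
- exact: (subalgM hA).
- exact: compl_primeM.
- by rewrite mulf_div.
Qed.

(** An ideal of the localization is generated by its trace on [A]: clear the denominator, then
    multiply by its inverse. *)
Lemma noetherian_localization : noetherian A -> noetherian S.
Proof.
move=> nA I [IS I0 ID IM]; have hS := localization_subalg.
have AS := sub_localization.
have [|s Is] := nA (I `&` A).
  split=> [z [] //||a b [Ia Aa] [Ib Ab]|a b Aa [Ib Ab]].
  - by split=> //; apply: subalg0 hA.
  - by split; [apply: ID|apply: (subalgD hA)].
  - by split; [apply: IM => //; apply: AS|apply: (subalgM hA)].
have sIA : [set` s] `<=` I `&` A by rewrite Is; exact: sub_gen_smallest.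
exists s; rewrite eqEsubset; split; last first.
  by apply: smallest_sub => // z /sIA [].
move=> z Iz; have [a [b [Aa Ab pb zE]]] := IS _ Iz.
have b0 := compl_prime_neq0 pb.
have [gS g0 gD gM] : is_ideal S (ideal_gen S [set` s]).
  by apply: (ideal_gen_ideal hS) => c /sIA [_ /AS].
rewrite zE mulrC; apply: (gM); first exact: localization_inv.
have : (I `&` A) a.
  by split=> //; rewrite -(divfK b0 a) -zE mulrC; apply: IM => //; apply: AS.
rewrite Is; suff: ideal_gen A [set` s] `<=` ideal_gen S [set` s] `&` A.
  by move=> h /h [].
apply: smallest_sub; last first.
  by move=> c sc; split; [exact: sub_gen_smallest|case: (sIA _ sc)].
split=> [c [] //||c d [gc Ac] [gd Ad]|c d Ac [gd Ad]].
- by split=> //; apply: subalg0 hA.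
- by split; [apply: gD|apply: (subalgD hA)].
- by split; [apply: gM => //; apply: AS|apply: (subalgM hA)].
Qed.

(** Recording that the denominator becomes invertible gives a description shared by localizations at
    a prime and by [A[1/b]]; [localization_localization] and [spec_localization] take it as
    hypothesis. *)
Lemma localization_fractions z : S z ->
  exists a b, [/\ A a, A b, b != 0, S b^-1 & z = a / b].
Proof.
move=> [a [b [Aa Ab pb ->]]]; exists a, b; split=> //.
  exact: compl_prime_neq0.
exact: localization_inv.
Qed.

(** Through this extension [dim_one], a condition on the local ring, applies to the primes of [A]
    below [p]. *)
Lemma prime_ideal_extend p' : is_prime_ideal A p' -> p' `<=` p ->
  is_prime_ideal S [set z | exists a b, [/\ p' a, A b, ~ p b & z = a / b]].
Proof.
move=> [[p'A p'0 p'D p'M] _ p'P] p'p; have p1 : ~ p 1 by case: hp.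
(* Membership does not depend on the fraction: if one representation has its numerator in [p'], all
   do. *)
have p'frac a b : A a -> A b -> ~ p b ->
    (exists c d, [/\ p' c, A d, ~ p d & a / b = c / d]) -> p' a.
  move=> Aa Ab pb [c [d [p'c Ad pd /eqP]]].
  rewrite eqr_div ?compl_prime_neq0 // => /eqP h.
  have /p'P : p' (a * d) by rewrite h mulrC; apply: p'M.
  by case=> // /p'p.
split=> [||_ _ [a1 [b1 [Aa1 Ab1 pb1 ->]]] [a2 [b2 [Aa2 Ab2 pb2 ->]]]].
- split=> [_ [a [b [p'a Ab pb ->]]]|||].
  + by exists a, b; split=> //; apply: p'A.
  + by exists 0, 1; rewrite mul0r; split=> //; apply: subalg1 hA.
  + move=> _ _ [a1 [b1 [pa1 Ab1 pb1 ->]]] [a2 [b2 [pa2 Ab2 pb2 ->]]].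
    exists (a1 * b2 + a2 * b1), (b1 * b2); split.
    * by rewrite [a1 * _]mulrC [a2 * _]mulrC; apply: p'D; apply: p'M.
    * exact: (subalgM hA).
    * exact: compl_primeM.
    * by rewrite addf_div ?compl_prime_neq0.
  + move=> _ _ [a1 [b1 [Aa1 Ab1 pb1 ->]]] [a2 [b2 [pa2 Ab2 pb2 ->]]].
    exists (a1 * a2), (b1 * b2); split; first exact: p'M.
    * exact: (subalgM hA).
    * exact: compl_primeM.
    * by rewrite mulf_div.
- rewrite -(divr1 1) => /(p'frac _ _ (subalg1 hA) (subalg1 hA) p1) /p'p.
  by [].
- rewrite mulf_div => /p'frac h.
  have /p'P : p' (a1 * a2).
    by apply: h; [apply: (subalgM hA)|apply: (subalgM hA)|apply: compl_primeM].
  by case=> // p'a; [left; exists a1, b1|right; exists a2, b2].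
Qed.

End Localization.

Lemma prime_ideal_pull A B q : is_subalg iota A -> A `<=` B -> is_prime_ideal B q ->
  is_prime_ideal A (q `&` A).
Proof.
move=> hA AB [[qB q0 qD qM] q1 qP]; split.
- split=> [z [] //||a b [qa Aa] [qb Ab]|a b Aa [qb Ab]].
  + by split=> //; apply: subalg0 hA.
  + by split; [apply: qD|apply: (subalgD hA)].
  + by split; [apply: qM => //; apply: AB|apply: (subalgM hA)].
- by case.
- move=> a b Aa Ab [qab _]; have := qP _ _ (AB _ Aa) (AB _ Ab) qab.
  by case=> h; [left|right].
Qed.

Lemma localization_localization A B q : is_subalg iota A -> is_subalg iota B ->
  A `<=` B ->
  (forall z, B z -> exists a b, [/\ A a, A b, b != 0, B b^-1 & z = a / b]) ->
  is_prime_ideal B q -> localization B q = localization A (q `&` A).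
Proof.
move=> hA hB AB frac hq; have [[qB q0 qD qM] q1 qP] := hq.
rewrite eqEsubset; split=> [_ [c [d [Bc Bd qd ->]]]|_ [a [b [Aa Ab qb ->]]]].
  have [a1 [b1 [Aa1 Ab1 b10 Bb1 cE]]] := frac _ Bc.
  have [a2 [b2 [Aa2 Ab2 b20 Bb2 dE]]] := frac _ Bd.
  have qu b : b != 0 -> B b^-1 -> ~ q b.
    by move=> b0 Bb /(qM _ _ Bb); rewrite mulVf.
  exists (a1 * b2), (b1 * a2); split; try exact: (subalgM hA).
    move=> [h _]; apply: (compl_primeM hq _ _ _ _ h); try exact: AB.
      exact: qu.
    by rewrite -(divfK b20 a2) -dE; apply: (compl_primeM hq) => //; [exact: AB|exact: qu].
  by rewrite cE dE invf_div mulf_div.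
exists a, b; split=> //; [exact: AB|exact: AB|].
by move=> h; apply: qb.
Qed.

(* A maximal element among the ideals (x : c z) with c z not in x is prime. *)
Lemma associated_prime x z : is_subalg iota x -> noetherian x -> ~ x z ->
  exists c, [/\ x c, ~ x (c * z) & is_prime_ideal x [set d | x d /\ x (d * (c * z))]].
Proof.
move=> hx nx xz; pose col c := [set d | x d /\ x (d * (c * z))].
pose F := [set q | exists c, [/\ x c, ~ x (c * z) & q = col c]].
have [||q [c [xc xcz ->]] qmax] := @noetherian_max _ x F nx.
- by exists (col 1); exists 1; rewrite mul1r; split=> //; apply: subalg1 hx.
- move=> _ [c [xc xcz ->]]; split=> [d [] //||a b [xa xa'] [xb xb']|a b xa [xb xb']].
  + by split; rewrite ?mul0r; apply: subalg0 hx.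
  + by split; rewrite ?mulrDl; apply: (subalgD hx).
  + by split; rewrite -?mulrA; apply: (subalgM hx).
have id1 : ~ col c 1 by rewrite /col /= mul1r => -[].
exists c; split=> //; split=> //.
  split=> [d [] //||a b [xa xa'] [xb xb']|a b xa [xb xb']].
  - by split; rewrite ?mul0r; apply: subalg0 hx.
  - by split; rewrite ?mulrDl; apply: (subalgD hx).
  - by split; rewrite -?mulrA; apply: (subalgM hx).
(* Unless [d] is in [col c], the ideal [col (d * c)] belongs to the family and contains [col c], so
   maximality makes them equal; and [e] lies in [col (d * c)]. *)
move=> d e xd xe [_ xde]; apply: contrapT => /not_orP[nd ne]; apply: ne.
apply: (qmax (col (d * c))).
- exists (d * c); split=> //; first exact: (subalgM hx).
  by rewrite -mulrA => h; apply: nd.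
- move=> f [xf xfcz]; split=> //.
  by rewrite -mulrA mulrCA; apply: (subalgM hx).
- by split=> //; rewrite -mulrA mulrA (mulrC e).
Qed.

(* Otherwise z m is contained in m, so that z is integral over P: the
   P-submodules of P spanned by a, z a, ..., z^n a stabilize for a in m. *)
Lemma max_ideal_principal P z : is_local P -> noetherian P -> integrally_closed P ->
  (exists2 a, max_ideal P a & a != 0) -> ~ P z ->
  (forall a, max_ideal P a -> P (a * z)) ->
  z != 0 /\ max_ideal P = [set z^-1 * b | b in P].
Proof.
move=> [hP hm] nP icP [a ma a0] Pz mz.
have [mP m0 mD mM] := hm.
case: (pselect (exists2 d, max_ideal P d & ~ max_ideal P (d * z))) => [[d md ndz]|hno].
  have [dz0 _ udz] := not_max_unit (mz _ md) ndz.
  have z0 : z != 0 by apply: contra_neq dz0 => ->; rewrite mulr0.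
  have d0 : d != 0 by apply: contra_neq dz0 => ->; rewrite mul0r.
  split=> //; rewrite eqEsubset; split=> [e me|_ [b Pb <-]].
    by exists (e * z); [exact: mz|rewrite mulrC mulfK].
  have -> : z^-1 = (d * z)^-1 * d by rewrite invfM mulrAC mulVf // mul1r.
  by rewrite mulrC; apply: (mM) => //; apply: (mM).
have mzm d : max_ideal P d -> max_ideal P (d * z).
  by move=> md; apply: contrapT => h; apply: hno; exists d.
have ma' n : max_ideal P (z ^+ n * a).
  elim: n => [|n IH]; first by rewrite expr0 mul1r.
  by rewrite exprSr mulrAC; apply: mzm.
pose I n := [set b | exists q : {poly K},
  [/\ coefs_in P q, (size q <= n)%N & b = q.[z] * a]].
have [n|n b [q [Pq sq ->]]|N hN] := @noetherian_chain _ P I nP.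
- split=> [_ [q [Pq sq ->]]||_ _ [q [Pq sq ->]] [r [Pr sr ->]]|c _ Pc [r [Pr sr ->]]].
  + rewrite horner_coef mulr_suml; apply: (subalg_sum _ hP) => i _; rewrite -mulrA.
    by apply: (subalgM hP) => //; apply: mP.
  + exists 0; rewrite horner0 mul0r size_poly0; split=> // i; rewrite coef0.
    exact: subalg0 hP.
  + exists (q + r); rewrite hornerD mulrDl; split=> //; first exact: (coefs_inD hP).
    by rewrite (leq_trans (size_polyD _ _)) // geq_max sq.
  + exists (c%:P * r); rewrite hornerM hornerC mulrA; split=> //.
      by apply: (coefs_inM hP) => //; apply: (coefs_inC hP).
    by rewrite mul_polyC (leq_trans (size_scale_leq _ _)).
- by exists q; split=> //; apply: leqW.
(* Stabilization puts [z ^+ N * a] among the values of size at most [N]; cancelling [a] leaves the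
   monic equation ['X^N - q] for [z]. *)
have [|q [Pq sq /(mulIf a0) qz]] := hN N.+1 (z ^+ N * a).
  exists 'X^N; rewrite hornerXn size_polyXn; split=> //; exact: coefs_inX hP.
case: Pz; apply: (icP z ('X^N - q)); last 1 first.
- by rewrite /root hornerD hornerN hornerXn qz subrr.
- apply/monicP; rewrite lead_coefDl ?lead_coefXn // size_polyXn size_polyN.
  by rewrite ltnS.
- by apply: (coefs_inB hP) => //; apply: coefs_inX hP.
Qed.

End LocalRings.

(** * Discrete valuation rings and primes of height one *)

Section DiscreteValuationRings.
Variables (k K : fieldType) (iota : {rmorphism k -> K}).
Implicit Types (A B I P x y : set K) (a b c t z : K) (s : seq K).

Definition uniformizer P t : Prop := t != 0 /\ max_ideal P = [set t * b | b in P].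

(** The decomposition is asked of all nonzero elements of [K], with integer exponents, so that [K]
    is the fraction field of [P] and [ord P] is defined on all of its nonzero elements. *)
Definition is_dvr P : Prop :=
  is_subalg iota P /\ exists2 t, uniformizer P t &
    forall a, a != 0 -> exists (n : int) u, unit_of P u /\ a = t ^ n * u.

Lemma uniformizer_mem P t : is_subalg iota P -> uniformizer P t -> max_ideal P t.
Proof. by move=> hP [t0 ->]; exists 1; [apply: subalg1 hP|rewrite mulr1]. Qed.

Lemma uniformizer_exp_unit P t (n : int) : is_subalg iota P -> uniformizer P t ->
  unit_of P (t ^ n) -> n = 0.
Proof.
move=> hP ut; have mt := uniformizer_mem hP ut; have [t0 _] := ut.
have hn m : unit_of P (t ^+ m) -> m = 0%N.
  case: m => // m [_ _ Pt]; case: (unit_not_max _ mt).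
  case: (mt) => Pt' _; split=> //.
  have -> : t^-1 = t ^+ m * (t ^+ m.+1)^-1.
    by rewrite exprS invfM mulrCA mulfV ?mulr1 // expf_neq0.
  by apply: (subalgM hP) => //; apply: (subalgX _ hP).
case: n => n; first by move=> /hn ->.
by rewrite NegzE -exprnN => /unit_ofV; rewrite invrK => /hn.
Qed.

(** [ord] selects an exponent for some uniformizer. Two uniformizers divide each other, hence differ
    by a unit [b], and only the zeroth power of a uniformizer is a unit. *)
Lemma ordE P t a u (n : int) : is_subalg iota P -> uniformizer P t ->
  unit_of P u -> a = t ^ n * u -> ord P a = n.
Proof.
move=> hP ut uu aE; apply: xget_unique.
  by exists t, u; case: ut.
move=> n' [t' [u' [t'0 mt' uu' aE']]].
have [t0 mt] := ut; have ut' : uniformizer P t' by [].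
have [b Pb t'b] : [set t * b | b in P] t'.
  by rewrite -mt; apply: uniformizer_mem hP ut'.
have [b' Pb' tb'] : [set t' * b | b in P] t by rewrite -mt'; apply: uniformizer_mem hP ut.
have b0 : b != 0 by apply: contra_neq t'0 => bE; rewrite -t'b bE mulr0.
have bb' : b * b' = 1.
  by apply: (mulfI t0); rewrite mulr1 mulrA t'b tb'.
have ub : unit_of P b.
  by split=> //; rewrite -[b^-1]mulr1 -bb' mulKf.
suff : n' - n = 0 by move/eqP; rewrite subr_eq0 => /eqP.
apply: (uniformizer_exp_unit hP ut).
have u0 : u' != 0 by case: uu'.
have -> : t ^ (n' - n) = u * (b ^ n' * u')^-1.
  rewrite expfzDr // -invr_expz; apply/eqP.
  by rewrite eqr_div ?mulf_neq0 ?expfz_neq0 // mulrA -expfzMl t'b -aE' aE mulrC.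
apply: (unit_ofM hP) => //; apply: unit_ofV; apply: (unit_ofM hP) => //.
exact: (unit_ofXz _ hP).
Qed.

Lemma is_dvr_ord P : is_dvr P -> exists2 t, uniformizer P t &
  forall a, a != 0 -> exists2 u, unit_of P u & a = t ^ (ord P a) * u.
Proof.
move=> [hP [t ut ht]]; exists t => // a /ht [n [u [uu aE]]].
by exists u => //; rewrite (ordE hP ut uu aE).
Qed.

Lemma ordM P a b : is_dvr P -> a != 0 -> b != 0 -> ord P (a * b) = ord P a + ord P b.
Proof.
move=> dP a0 b0; have [t ut h] := is_dvr_ord dP; have [hP _] := dP.
have [t0 _] := ut.
have [u uu aE] := h _ a0; have [v uv bE] := h _ b0.
apply: (ordE hP ut (unit_ofM hP uu uv)).
by rewrite {1}aE {1}bE mulrACA expfzDr.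
Qed.

Lemma ord1 P : is_dvr P -> ord P 1 = 0.
Proof.
move=> dP; have := ordM dP (oner_neq0 K) (oner_neq0 K).
by rewrite mulr1 => /eqP; rewrite -subr_eq0 opprD addrA subrr add0r oppr_eq0 => /eqP.
Qed.

Lemma ordV P a : is_dvr P -> a != 0 -> ord P a^-1 = - ord P a.
Proof.
move=> dP a0; have a0' : a^-1 != 0 by rewrite invr_eq0.
have /esym/eqP := ordM dP a0' a0; rewrite mulVf // (ord1 dP) addr_eq0.
by move/eqP.
Qed.

Lemma ordX P a n : is_dvr P -> a != 0 -> ord P (a ^+ n) = n%:Z * ord P a.
Proof.
move=> dP a0; elim: n => [|n IH]; first by rewrite expr0 ord1 // mul0r.
by rewrite exprS ordM ?expf_neq0 // IH intS mulrDl mul1r.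
Qed.

Lemma ordXz P a (n : int) : is_dvr P -> a != 0 -> ord P (a ^ n) = n * ord P a.
Proof.
move=> dP a0; case: n => n; first exact: ordX.
by rewrite NegzE -exprnN ordV ?expf_neq0 // ordX // mulNr.
Qed.

Lemma ord_prod P (J : Type) (r : seq J) (F : J -> K) : is_dvr P ->
  (forall i, F i != 0) ->
  \prod_(i <- r) F i != 0 /\ ord P (\prod_(i <- r) F i) = \sum_(i <- r) ord P (F i).
Proof.
move=> dP F0; elim: r => [|i r [r0 IH]]; first by rewrite !big_nil oner_eq0 ord1.
by rewrite !big_cons mulf_neq0 // ordM // IH.
Qed.

Lemma ord_unit P u : is_dvr P -> unit_of P u -> ord P u = 0.
Proof.
move=> dP uu; have [t ut _] := is_dvr_ord dP; have [hP _] := dP.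
by apply: (ordE hP ut uu); rewrite expr0z mul1r.
Qed.

Lemma ord_ge0P P a : is_dvr P -> a != 0 -> (0 <= ord P a) <-> P a.
Proof.
move=> dP a0; have [t ut h] := is_dvr_ord dP; have [hP _] := dP.
have [u uu aE] := h _ a0; have [Pt _] := uniformizer_mem hP ut.
have pos b : b != 0 -> 0 <= ord P b -> P b.
  move=> b0; have [v [_ Pv _] bE] := h _ b0; case: (ord P b) bE => // n -> _.
  by apply: (subalgM hP) => //; apply: (subalgX _ hP).
split=> [|Pa]; first exact: pos.
rewrite leNgt; apply/negP => neg.
have ua : unit_of P a.
  by split=> //; apply: pos; rewrite ?invr_eq0 // ordV // oppr_ge0 ltW.
by move: neg; rewrite ord_unit.
Qed.

Lemma ord_gt0P P a : is_dvr P -> a != 0 -> (0 < ord P a) <-> max_ideal P a.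
Proof.
move=> dP a0; split=> [pos|[Pa nu]].
  split; first by apply/(ord_ge0P dP) => //; apply: ltW.
  by move=> /(ord_unit dP) ord0; rewrite ord0 in pos.
rewrite lt_def; apply/andP; split; last by apply/(ord_ge0P dP).
apply/eqP => ord0; apply: nu; split=> //.
by apply/(ord_ge0P dP); rewrite ?invr_eq0 // ordV // ord0.
Qed.

Lemma is_dvr_valuation P : is_dvr P -> is_valuation_ring iota P.
Proof.
move=> dP; split=> [|a a0]; first by case: dP.
have a0' : a^-1 != 0 by rewrite invr_eq0.
case: (lerP 0 (ord P a)) => h; [left|right]; apply/(ord_ge0P dP) => //.
by rewrite ordV // oppr_ge0 ltW.
Qed.

(** A nonzero prime contains a power of the uniformizer, hence the uniformizer. This certifies that
    the rings produced by [dvr_separates] are prime divisors. *)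
Lemma is_dvr_dim_one P : is_dvr P -> dim_one P.
Proof.
move=> dP; have [t ut h] := is_dvr_ord dP; have [hP _] := dP.
have mt := uniformizer_mem hP ut; have [t0 mE] := ut; split.
  by move=> m0; move: mt t0; rewrite m0 => /= ->; rewrite eqxx.
move=> p [[pP p0 pD pM] p1 pp].
case: (pselect (exists2 a, p a & a != 0)) => [[a pa a0]|hno]; [right|left]; last first.
  rewrite eqEsubset; split=> [a pa|_ ->] //=; apply: contrapT => /eqP a0.
  by apply: hno; exists a.
have pt : p t.
  have := pP _ pa; move=> /(ord_ge0P dP a0); have [u [u0 Pu Pu'] aE] := h _ a0.
  case: (ord P a) aE => // n aE _.
  have {pa} : p (t ^+ n).
    by rewrite -[t ^+ n](mulfK u0) -aE mulrC; apply: pM.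
  have [Pt _] := mt; elim: n {aE} => [//|n IH].
  rewrite exprS => /pp; case=> //; exact: (subalgX _ hP).
rewrite eqEsubset; split=> [c pc|].
  split; first exact: pP.
  by case=> c0 _ Pc; apply: p1; rewrite -(mulVf c0); apply: pM.
by rewrite mE => _ [b Pb <-]; rewrite mulrC; apply: pM.
Qed.

Lemma has_fraction_fieldS A B : A `<=` B -> has_fraction_field A -> has_fraction_field B.
Proof.
move=> AB h z; have [a [b [Aa Ab b0 ->]]] := h z.
by exists a, b; split=> //; apply: AB.
Qed.

(** If [a] is never a power of [t] times a unit, every [a / t ^+ n] lies in [P]. The ideals they
    generate increase, and stabilization would put the inverse of [t] in [P]. *)
Lemma is_dvr_of_uniformizer P t : is_local iota P -> noetherian P ->
  has_fraction_field P -> uniformizer P t -> is_dvr P.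
Proof.
move=> [hP hm] nP fP ut; split=> //; exists t => //.
have [Pt _] := uniformizer_mem hP ut; have [t0 mE] := ut.
have main a : a != 0 -> P a -> exists (n : int) u, unit_of P u /\ a = t ^ n * u.
  move=> a0 Pa; apply: contrapT => hno.
  have Pn n : P (a / t ^+ n).
    elim: n => [|n IH]; first by rewrite expr0 divr1.
    have tn0 : t ^+ n != 0 by rewrite expf_neq0.
    have : max_ideal P (a / t ^+ n).
      apply: contrapT => /(not_max_unit IH) uu; apply: hno.
      by exists n%:Z, (a / t ^+ n); split=> //; rewrite -exprnP mulrC divfK.
    rewrite mE => -[b Pb h].
    by rewrite exprS invfM mulrA mulrAC -h mulrAC mulfV // mul1r.
  (* This is the ideal generated by [a / t ^+ n], since [Pn] puts that quotient in [P]. *)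
  pose I n := [set c | P c /\ exists2 d, P d & t ^+ n * c = d * a].
  have [n|n c [Pc [d Pd h]]|N hN] := @noetherian_chain _ P I nP.
  - split=> [c []|| |] //.
    + split; first exact: subalg0 hP.
      by exists 0; rewrite ?mulr0 ?mul0r //; apply: subalg0 hP.
    + move=> b c [Pb [d Pd hb]] [Pc [e Pe hc]]; split; first exact: (subalgD hP).
      by exists (d + e); rewrite ?mulrDr ?mulrDl ?hb ?hc //; apply: (subalgD hP).
    + move=> b c Pb [Pc [e Pe hc]]; split; first exact: (subalgM hP).
      by exists (b * e); [exact: (subalgM hP)|rewrite mulrCA hc mulrA].
  - split=> //; exists (t * d); first exact: (subalgM hP).
    by rewrite exprS -!mulrA h.
  have [|_ [d Pd]] := hN N.+1 (a / t ^+ N.+1).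
    split=> //; exists 1; first exact: subalg1 hP.
    by rewrite mul1r mulrC divfK // expf_neq0.
  have -> : t ^+ N * (a / t ^+ N.+1) = t^-1 * a.
    rewrite exprS invfM mulrCA [t ^+ N * _]mulrCA mulfV ?expf_neq0 //.
    by rewrite mulr1 mulrC.
  move/(mulIf a0) => td; have mt := uniformizer_mem hP ut.
  by case: (unit_not_max _ mt); split; rewrite ?td.
move=> z z0; have [a [b [Pa Pb b0 zE]]] := fP z.
have a0 : a != 0 by apply: contra_neq z0 => aE; rewrite zE aE mul0r.
have [n [u [uu aE]]] := main _ a0 Pa; have [m [v [uv bE]]] := main _ b0 Pb.
exists (n - m), (u * v^-1); split.
  by apply: (unit_ofM hP) => //; apply: unit_ofV.
by rewrite zE aE bE -mulf_div expfzDr // -invr_expz.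
Qed.

(** For a nonzero nonunit [a], a prime associated with [a^-1] contains [a], so dimension one makes
    it the maximal ideal. Then [c / a] multiplies the maximal ideal into [P] without lying in [P],
    and its inverse is a uniformizer. *)
Lemma dim_one_dvr P : is_local iota P -> noetherian P -> has_fraction_field P ->
  integrally_closed P -> dim_one P -> is_dvr P.
Proof.
move=> lP nP fP icP [m0 dimP]; have [hP hm] := lP.
have [a ma a0] : exists2 a, max_ideal P a & a != 0.
  apply: contrapT => hno; apply: m0; rewrite eqEsubset; split=> [a ma|_ ->] /=.
    by apply: contrapT => /eqP a0; apply: hno; exists a.
  exact: max_ideal0 hP.
have [Pa nua] := ma.
have Pa' : ~ P a^-1 by move=> Pa'; apply: nua.
have [c [Pc ncz pq]] := associated_prime hP nP Pa'.
case: (dimP _ pq) => [q0|qm].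
  have : [set d | P d /\ P (d * (c / a))] a.
    by split=> //; rewrite mulrC divfK.
  by rewrite q0 /= => aE; rewrite aE eqxx in a0.
have [||z0 mE] := max_ideal_principal lP nP icP _ ncz; first by exists a.
  by move=> d; rewrite -qm => -[].
apply: is_dvr_of_uniformizer lP nP fP _; split; last exact: mE.
by rewrite invr_eq0.
Qed.

(* The prime associated with z modulo x becomes principal in its localization. *)
Lemma dvr_separates x z : is_subalg iota x -> noetherian x -> has_fraction_field x ->
  (forall q, is_prime_ideal x q -> integrally_closed (localization x q)) -> ~ x z ->
  exists q, [/\ is_prime_ideal x q, is_dvr (localization x q) &
    ~ localization x q z].
Proof.
move=> hx nx fx icx xz; have [c [xc ncz pq]] := associated_prime hx nx xz.
set q := (X in is_prime_ideal x X) in pq.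
have xy := sub_localization hx pq; have hy := localization_subalg hx pq.
have ly := localization_local hx pq; have ny := noetherian_localization hx pq nx.
(* By its definition [q] contains every denominator of [c * z]. *)
have ncy : ~ localization x q (c * z).
  move=> [d [e [xd xe qe czE]]]; have e0 := compl_prime_neq0 pq qe.
  apply: qe; split=> //.
  by rewrite czE mulrC divfK.
exists q; split=> //; last by move=> yz; apply: ncy; apply: (subalgM hy) => //; apply: xy.
have [||z0 mE] := max_ideal_principal ly ny (icx _ pq) _ ncy.
- have [a [b [xa xb b0 zE]]] := fx z; exists b => //.
  rewrite (localization_max pq); exists b, 1; rewrite divr1; split=> //.
  + by split=> //; rewrite zE mulrC -mulrA divfK //; apply: (subalgM hx).
  + exact: subalg1 hx.
  + by case: pq.
- move=> d; rewrite (localization_max pq) => -[a [b [[xa xacz] xb qb ->]]].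
  rewrite mulrAC; apply: (subalgM hy); first exact: xy.
  exact: (localization_inv hx).
apply: (@is_dvr_of_uniformizer _ (c * z)^-1) => //.
  exact: has_fraction_fieldS fx.
by split; rewrite ?invr_eq0.
Qed.

(* An ideal maximal among the nonzero ideals contained in infinitely many primes
   of height one would be prime, hence contained in at most one of them. *)
Lemma finite_dim_one_primes A a : is_subalg iota A -> noetherian A -> A a -> a != 0 ->
  finite_set [set p | [/\ is_prime_ideal A p, dim_one (localization A p) & p a]].
Proof.
move=> hA nA Aa a0.
pose V I := [set p | [/\ is_prime_ideal A p, dim_one (localization A p) & I `<=` p]].
pose bad I := [/\ is_ideal A I, exists2 c, I c & c != 0 & ~ finite_set (V I)].
suff good I : ~ bad I.
  apply: contrapT => nf; apply: (good (ideal_gen A [set a])); split.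
  - by apply: (ideal_gen_ideal hA) => _ ->.
  - by exists a => //; apply: sub_gen_smallest.
  - apply: contra_not nf; apply: sub_finite_set => p [pp dp pa]; split=> //.
    by apply: smallest_sub; [case: pp|move=> _ ->].
move=> badI; have [||J [hJ [c Jc c0] nJ] Jmax] := @noetherian_max _ A bad nA.
- by exists I.
- by move=> J [].
have [JA J0 JD JM] := hJ.
have J1 : ~ J 1.
  move=> J1; apply: nJ; rewrite (_ : V J = set0) //; rewrite -subset0 => p [[_ p1 _] _ Jp].
  by apply: p1; apply: Jp.
have grow b : A b -> ~ J b -> finite_set (V [set z | exists i d, [/\ J i, A d & z = i + d * b]]).
  move=> Ab Jb; set J' := (X in V X); have A0 := subalg0 hA.
  have JJ' : J `<=` J' by move=> i Ji; exists i, 0; rewrite mul0r addr0.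
  apply: contrapT => nf; apply: Jb; apply: (Jmax J') => //; last first.
    by exists 0, 1; rewrite mul1r add0r; split=> //; apply: subalg1 hA.
  split=> //; last by exists c => //; apply: JJ'.
  split.
  - by move=> _ [i [d [Ji Ad ->]]]; apply: (subalgD hA); [apply: JA|apply: (subalgM hA)].
  - exact: JJ'.
  - move=> _ _ [i [d [Ji Ad ->]]] [j [e [Jj Ae ->]]]; exists (i + j), (d + e).
    by rewrite addrACA -mulrDl; split=> //; [exact: JD|exact: (subalgD hA)].
  - move=> e _ Ae [i [d [Ji Ad ->]]]; exists (e * i), (e * d).
    by rewrite mulrDr mulrA; split=> //; [exact: JM|exact: (subalgM hA)].
(* A prime [J] below [p] extends to a nonzero prime of the localization at [p], which by dimension
   one is maximal; so [p = J] is the only possibility. *)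
case: (pselect (is_prime_ideal A J)) => pJ.
  apply: nJ; apply: (@sub_finite_set _ _ [set J]); last exact: finite_set1.
  move=> p [pp [_ dp] Jp]; rewrite /= eqEsubset; split=> //.
  have := dp _ (prime_ideal_extend hA pp pJ Jp).
  set E := [set _ | _].
  have subE z : J z -> E z.
    move=> Jz; exists z, 1; rewrite divr1; split=> //; first exact: subalg1 hA.
    by case: pp.
  case=> EE; first by have := subE _ Jc; rewrite EE /= => cE; rewrite cE eqxx in c0.
  move=> z pz; have Az := prime_ideal_sub pp pz.
  have [mz _] : (max_ideal (localization A p) `&` A) z by rewrite (localization_maxA hA pp).
  have [b [d [Jb Ad pd zE]]] : E z by move: mz; rewrite -EE.
  have d0 := compl_prime_neq0 pp pd.
  have : J (z * d) by rewrite zE divfK.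
  by case: pJ => _ _ h /h; case=> // /Jp.
apply: pJ; split=> // b d Ab Ad Jbd; apply: contrapT => /not_orP[nb nd].
(* A prime containing [J] contains [b] or [d], hence one of the two strictly larger ideals to which
   [grow] applies. *)
apply: nJ; apply: (@sub_finite_set _ _ (_ `|` _)); last first.
  by rewrite finite_setU; split; [exact: (grow _ Ab nb)|exact: (grow _ Ad nd)].
move=> p [pp dp Jp]; have [[pA p0 pD pM] _ pP] := pp.
have := pP _ _ Ab Ad (Jp _ Jbd).
case=> h; [left|right]; split=> // _ [i [e [Ji Ae ->]]].
  by apply: pD; [apply: Jp|apply: pM].
by apply: pD; [apply: Jp|apply: pM].
Qed.

End DiscreteValuationRings.

(** * Existence of dominating valuation rings *)

Section ValuationRings.
Variables (k K : fieldType) (iota : {rmorphism k -> K}).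
Implicit Types (A B I x y V : set K) (a b c z : K) (q r : {poly K}).

Lemma coefs_in_ideal B I q r : is_ideal B I -> coefs_in B q -> coefs_in I r ->
  coefs_in I (q * r).
Proof.
move=> hI hq hr i; rewrite coefM; apply: (ideal_sum _ hI) => j _.
by case: hI => _ _ _; apply.
Qed.

Definition extended_ideal I a : set K := [set q.[a] | q in coefs_in I].

Lemma extended_ideal_ideal B I a : is_subalg iota B -> is_ideal B I ->
  is_ideal (adjoin B a) (extended_ideal I a).
Proof.
move=> hB hI; have [IB I0 ID IM] := hI; split.
- by move=> _ [q hq <-]; exists q => // i; apply: IB.
- by exists 0; rewrite ?horner0 // => i; rewrite coef0.
- move=> _ _ [q hq <-] [r hr <-]; exists (q + r); rewrite ?hornerD // => i.
  by rewrite coefD; apply: ID.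
- move=> _ _ [q hq ->] [r hr <-]; exists (q * r); rewrite ?hornerM //.
  exact: coefs_in_ideal hI hq hr.
Qed.

(* If 1 is a value at a of a polynomial of degree n and a value at 1/a of a
   polynomial of degree m <= n, both with coefficients in I, then the second
   relation expresses (1 - r_0) a^n through lower powers of a. *)
Lemma extended_ideal_inv B I a n m q r : is_subalg iota B -> is_ideal B I ->
  ~ I 1 -> a != 0 -> coefs_in I q -> coefs_in I r ->
  (size q <= n.+1)%N -> (size r <= m.+1)%N -> q.[a] = 1 -> r.[a^-1] = 1 -> False.
Proof.
move=> hB hI I1; have [IB I0 ID IM] := hI.
have [N] := ubnP (n + m); elim: N => // N IH in n m a q r *.
wlog mn : n m a q r / (m <= n)%N.
  move=> hwlog; case: (leqP m n) => [mn|/ltnW nm]; first exact: hwlog.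
  move=> lt_N a0 hq hr sq sr qa ra.
  apply: (hwlog m n a^-1 r q nm) => //; first by rewrite addnC.
    by rewrite invr_eq0.
  by rewrite invrK.
rewrite ltnS => le_N a0 hq hr sq sr qa ra.
case: n => [|n] in mn le_N sq *.
  by move: qa; rewrite (size1_polyC sq) hornerC => q1; apply: I1; rewrite -q1.
pose c := 1 - r`_0.
have Bc : B c by apply: (subalgB hB); [apply: subalg1 hB|apply: IB].
(* This is the relation for [a^-1] multiplied by [a ^+ n.+1], with the constant term moved to the
   left. As [m <= n.+1], the subtraction [n - j] never truncates. *)
pose u := \sum_(j < m) r`_j.+1 *: ('X^(n - j) : {poly K}).
have ua : c * a ^+ n.+1 = u.[a].
  have an0 : a ^+ n.+1 != 0 by rewrite expf_neq0.
  rewrite horner_sum /c mulrBl mul1r -{1}[a ^+ n.+1]mul1r -{1}ra.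
  rewrite (horner_coef_wide _ sr) big_ord_recl expr0 mulr1 mulrDl addrAC subrr add0r.
  rewrite mulr_suml; apply: eq_bigr => j _.
  rewrite hornerZ hornerXn lift0 -mulrA exprVn; congr (_ * _).
  have -> : n.+1 = (j.+1 + (n - j))%N.
    by rewrite addSn subnKC // -ltnS (leq_trans (ltn_ord j)).
  by rewrite exprD mulKf // expf_neq0.
pose q' := \sum_(i < n.+1) q`_i *: ('X^i : {poly K}).
have qE : q.[a] = q'.[a] + q`_n.+1 * a ^+ n.+1.
  rewrite (horner_coef_wide _ sq) big_ord_recr; congr (_ + _).
  by rewrite horner_sum; apply: eq_bigr => i _; rewrite hornerZ hornerXn.
have coefI (F : nat -> K) (e : nat -> nat) d : (forall i, I (F i)) ->
    coefs_in I (\sum_(i < d) F i *: ('X^(e i) : {poly K})).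
  move=> hF i; rewrite coef_sum; apply: (ideal_sum _ hI) => j _.
  rewrite coefZ coefXn; case: eqP => _; first by rewrite mulr1.
  by rewrite mulr0.
have size_lin (F : nat -> K) (e : nat -> nat) d :
    (forall i, (i < d)%N -> (e i <= n)%N) ->
    (size (\sum_(i < d) F i *: ('X^(e i) : {poly K}))%R <= n.+1)%N.
  move=> he; apply: (leq_trans (size_sum _ _ _)); apply/bigmax_leqP => i _.
  by rewrite (leq_trans (size_scale_leq _ _)) // size_polyXn ltnS he.
(* Multiply the relation for [a] by [c = 1 - r_0], replace [c * a ^+ n.+1] by the value of [u], and
   add [r_0]: the value at [a] is again 1, the coefficients stay in [I], and the degree has
   dropped. *)
pose v := (r`_0)%:P + c *: q' + q`_n.+1 *: u.
have hu : coefs_in I u by apply: (coefI (fun j => r`_j.+1) (fun j => (n - j)%N)).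
have hq' : coefs_in I q' by apply: (coefI (fun i => q`_i) id).
have cI d w : B d -> coefs_in I w -> coefs_in I (d *: w).
  by move=> Bd hw i; rewrite coefZ; apply: IM.
apply: (IH n m a v r) => //.
- move=> i; rewrite !coefD; apply: (ID); first apply: (ID).
  + by rewrite coefC; case: eqP.
  + exact: cI.
  + by apply: cI => //; apply: IB.
- rewrite (leq_trans (size_polyD _ _)) // geq_max (leq_trans (size_polyD _ _)) ?geq_max /=.
    rewrite (leq_trans (size_scale_leq _ _)) //.
    apply: (size_lin (fun j => r`_j.+1) (fun j => (n - j)%N)) => j _.
    exact: leq_subr.
  rewrite (leq_trans (size_polyC_leq1 _)) // (leq_trans (size_scale_leq _ _)) //.
  exact: (size_lin (fun i => q`_i) id).
- have -> : v.[a] = r`_0 + c * (q'.[a] + q`_n.+1 * a ^+ n.+1).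
    rewrite /v !hornerE -ua -addrA; congr (_ + _).
    by rewrite mulrDr mulrCA.
  by rewrite -qE qa mulr1 addrC subrK.
Qed.

(* Chevalley's extension theorem, by Zorn's lemma for the pairs of a subalgebra
   B and a proper ideal I of B. *)
Lemma valuation_ring_dominating y : is_local iota y ->
  exists2 V, is_valuation_ring iota V & dominates V y.
Proof.
move=> [hy hm].
pose good (BI : set K * set K) := [/\ is_subalg iota BI.1, is_ideal BI.1 BI.2,
  ~ BI.2 1, y `<=` BI.1 & max_ideal y `<=` BI.2].
have good0 : good (y, max_ideal y) by split=> //; apply: max_ideal1 hy.
pose T := {BI | good BI}.
pose le (s t : T) : bool := `[< (sval s).1 `<=` (sval t).1 /\ (sval s).2 `<=` (sval t).2 >].
have [||F Ftot|[[B I] gBI] BImax] := @ZL_preorder T (exist _ _ good0) le.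
- by move=> t; apply/asboolP; split.
- move=> r s t /asboolP[rs rs'] /asboolP[st st']; apply/asboolP; split.
    exact: subset_trans st.
  exact: subset_trans st'.
- case: (pselect (F !=set0)) => [[t0 Ft0]|F0]; last first.
    by exists (exist _ _ good0) => s Fs; case: F0; exists s.
  pose B := \bigcup_(t in F) (sval t).1; pose I := \bigcup_(t in F) (sval t).2.
  have both s t : F s -> F t -> exists u : T, [/\ F u, (sval s).1 `<=` (sval u).1,
      (sval s).2 `<=` (sval u).2, (sval t).1 `<=` (sval u).1 & (sval t).2 `<=` (sval u).2].
    move=> Fs Ft; case: (Ftot _ _ Fs Ft) => /asboolP[h1 h2].
      by exists t; split.
    by exists s; split.
  have gBI : good (B, I).
    split=> /=.
    + split=> [c|a b [s Fs sa] [t Ft tb]|a b [s Fs sa] [t Ft tb]].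
      * by exists t0 => //; case: (svalP t0) => h _ _ _ _; apply: subalg_scalar h.
      * have [u [Fu su _ tu _]] := both _ _ Fs Ft; exists u => //.
        by case: (svalP u) => h _ _ _ _; apply: (subalgB h); [apply: su|apply: tu].
      * have [u [Fu su _ tu _]] := both _ _ Fs Ft; exists u => //.
        by case: (svalP u) => h _ _ _ _; apply: (subalgM h); [apply: su|apply: tu].
    + split=> [a [t Ft ta]||a b [s Fs sa] [t Ft tb]|a b [s Fs sa] [t Ft tb]].
      * by exists t => //; case: (svalP t) => _ [h _ _ _] _ _ _; apply: h.
      * by exists t0 => //; case: (svalP t0) => _ [].
      * have [u [Fu _ su _ tu]] := both _ _ Fs Ft; exists u => //.
        by case: (svalP u) => _ [_ _ h _] _ _ _; apply: h; [apply: su|apply: tu].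
      * have [u [Fu su _ _ tu]] := both _ _ Fs Ft; exists u => //.
        by case: (svalP u) => _ [_ _ _ h] _ _ _; apply: h; [apply: su|apply: tu].
    + by move=> [t Ft t1]; case: (svalP t).
    + by move=> a ya; exists t0 => //; case: (svalP t0) => _ _ _ h _; apply: h.
    + by move=> a ya; exists t0 => //; case: (svalP t0) => _ _ _ _ h; apply: h.
  exists (exist _ _ gBI) => s Fs; apply/asboolP; split=> /= a sa; by exists s.
have [/= hB hI I1 yB mI] := gBI.
(* If the ideal stays proper in [B[a]], the enlarged pair is still [good], and maximality gives
   [B[a] = B]. *)
have inB a : ~ extended_ideal I a 1 -> B a.
  move=> ha.
  have gBa : good (adjoin B a, extended_ideal I a).
    split=> //=.
    - exact: adjoin_subalg.
    - exact: (extended_ideal_ideal _ hB hI).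
    - by move=> b /yB; apply: (sub_adjoin _ hB).
    - move=> b /mI Ib; exists b%:P; rewrite ?hornerC // => i.
      by rewrite coefC; case: eqP => // _; case: hI.
  have leBa : le (exist _ _ gBI) (exist _ _ gBa).
    apply/asboolP; split=> /=; first exact: (sub_adjoin _ hB).
    move=> b Ib; exists b%:P; rewrite ?hornerC // => i.
    by rewrite coefC; case: eqP => // _; case: hI.
  by have /asboolP[/= h _] := BImax _ leBa; apply: h; apply: (adjoin_gen _ hB).
exists B; last first.
  split=> // a ma; have Ia := mI _ ma; split; first by apply: yB; case: ma.
  by case=> a0 _ Ba; apply: I1; rewrite -(mulVf a0); case: hI => _ _ _; apply.
split=> // a a0; apply: contrapT => /not_orP[na na'].
have [q hq qa] : extended_ideal I a 1 by apply: contrapT => /inB.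
have [r hr ra] : extended_ideal I a^-1 1 by apply: contrapT => /inB.
exact: (extended_ideal_inv hB hI I1 a0 hq hr (leqnSn _) (leqnSn _) qa ra).
Qed.

End ValuationRings.

(** * Points, open sets and prime divisors of a normal variety *)

Section VarietyPoints.
Variables (k K : fieldType) (iota : {rmorphism k -> K}).
Implicit Types (X U W : set (set K)) (A B P Q x y : set K) (s : seq K) (a b z : K).

Lemma spec_sub A x : is_subalg iota A -> spec A x -> A `<=` x.
Proof. by move=> hA [p pp ->]; apply: (sub_localization hA pp). Qed.

Lemma spec_local A x : is_subalg iota A -> spec A x -> is_local iota x.
Proof. by move=> hA [p pp ->]; apply: (localization_local hA pp). Qed.

Lemma spec_noetherian A x : is_subalg iota A -> noetherian A -> spec A x ->
  noetherian x.
Proof. by move=> hA nA [p pp ->]; apply: (noetherian_localization hA pp). Qed.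

Lemma spec_center A y : is_subalg iota A -> is_local iota y -> A `<=` y ->
  spec A (localization A (max_ideal y `&` A)) /\
  dominates y (localization A (max_ideal y `&` A)).
Proof.
move=> hA ly Ay; have [hy _] := ly.
have pq := prime_ideal_pull hA Ay (max_ideal_prime ly).
split; first by exists (max_ideal y `&` A).
have unit b : A b -> ~ (max_ideal y `&` A) b -> unit_of y b.
  by move=> Ab nb; apply: not_max_unit; [apply: Ay|move=> mb; apply: nb].
split=> [_ [a [b [Aa Ab nb ->]]]|z].
  have [_ _ yb] := unit _ Ab nb; apply: (subalgM hy) => //; exact: Ay.
rewrite (localization_max pq) => -[a [b [[ma Aa] Ab nb ->]]].
have [_ _ yb] := unit _ Ab nb; rewrite mulrC.
by case: (max_ideal_prime ly) => [[_ _ _ h]] _ _; apply: h.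
Qed.

Lemma spec_localization A B y : is_subalg iota A -> is_subalg iota B -> A `<=` B ->
  (forall z, B z -> exists a b, [/\ A a, A b, b != 0, B b^-1 & z = a / b]) ->
  spec B y -> spec A y.
Proof.
move=> hA hB AB frac [q pq ->]; exists (q `&` A); first exact: (prime_ideal_pull hA AB pq).
exact: (localization_localization hA hB).
Qed.

Lemma variety_chart X x : is_variety iota X -> X x -> exists s,
  let A := alg_gen iota [set` s] in
  [/\ has_fraction_field A, spec A `<=` X & spec A x].
Proof.
move=> [_ [charts [ch XE]] _]; rewrite {1}XE => -[s cs sx].
exists s; split=> //; first exact: ch.
by rewrite XE => y sy; exists s.
Qed.

Lemma variety_local X x : is_variety iota X -> X x -> is_local iota x.
Proof.
move=> vX /(variety_chart vX)[s [_ _ sx]].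
by apply: spec_local sx; apply: alg_gen_subalg.
Qed.

Lemma variety_noetherian X x : is_variety iota X -> X x -> noetherian x.
Proof.
move=> vX /(variety_chart vX)[s [_ _ sx]].
by apply: (spec_noetherian (alg_gen_subalg iota _) _ sx); apply: noetherian_alg_gen.
Qed.

Lemma variety_fractions X x : is_variety iota X -> X x -> has_fraction_field x.
Proof.
move=> vX /(variety_chart vX)[s [fs _ sx]].
by apply: (has_fraction_fieldS _ fs); apply: (spec_sub (alg_gen_subalg iota _) sx).
Qed.

(** Varieties are stable under generization: on a chart, a localization of a localization is a
    localization of the coordinate ring. *)
Lemma variety_localization X x q : is_variety iota X -> X x -> is_prime_ideal x q ->
  X (localization x q).
Proof.
move=> vX Xx pq; have [s [_ sX sx]] := variety_chart vX Xx; apply: sX.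
have hA := alg_gen_subalg iota [set` s]; have [hx _] := spec_local hA sx.
apply: (spec_localization hA hx (spec_sub hA sx)); last by exists q.
by case: sx => p pp -> z; apply: (localization_fractions hA pp).
Qed.

(* By separatedness, a valuation ring dominating y has the same center on X
   as on Spec A. *)
Lemma spec_open X A y : is_variety iota X -> is_subalg iota A -> spec A `<=` X ->
  X y -> A `<=` y -> spec A y.
Proof.
move=> vX hA AX Xy Ay; have ly := variety_local vX Xy.
have [sc dc] := spec_center hA ly Ay.
have [V vV dV] := valuation_ring_dominating ly.
have [_ _ sep] := vX.
by rewrite (sep V _ _ vV Xy (AX _ sc) dV (dominates_trans dV dc)).
Qed.

Lemma spec_zopen X s : is_variety iota X -> spec (alg_gen iota [set` s]) `<=` X ->
  zopen X (spec (alg_gen iota [set` s])).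
Proof.
move=> vX sX; split=> // x sx; have hA := alg_gen_subalg iota [set` s].
exists s; split; first by move=> a sa; apply: (spec_sub hA sx); apply: sub_gen_smallest.
move=> y [Xy sy]; apply: (spec_open vX hA sX Xy).
by apply: smallest_sub => //; case: (variety_local vX Xy).
Qed.

Lemma common_denominator A p s : is_subalg iota A -> is_prime_ideal A p ->
  [set` s] `<=` localization A p ->
  exists b, [/\ A b, ~ p b & forall a, a \in s -> A (b * a)].
Proof.
move=> hA pp; elim: s => [|z s IH] hs.
  by exists 1; split=> //; [apply: subalg1 hA|case: pp].
have [b [Ab pb hb]] : exists b, [/\ A b, ~ p b & forall a, a \in s -> A (b * a)].
  by apply: IH => a sa; apply: hs; rewrite /= inE; apply/orP; right.
have [c [d [Ac Ad pd zE]]] : localization A p z by apply: hs; rewrite /= mem_head.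
exists (b * d); split; first exact: (subalgM hA).
  exact: (compl_primeM pp).
move=> a; rewrite inE => /orP[/eqP ->|/hb h]; last first.
  by rewrite mulrAC; apply: (subalgM hA).
by rewrite zE -mulrA [d * _]mulrC divfK; [apply: (subalgM hA)|apply: (compl_prime_neq0 pp)].
Qed.

(** The functions that define a basic neighbourhood inside [W] have a common denominator [b] on a
    chart, invertible at [x]; the spectrum of [A[1/b]] is the required set. *)
Lemma affine_open_nbhs X W x : is_variety iota X -> zopen X W -> W x ->
  exists U, [/\ affine_open iota X U, U x & U `<=` W].
Proof.
move=> vX [WX hW] Wx; have Xx := WX _ Wx.
have [s [sx sW]] := hW _ Wx.
have [s0 [_ s0X s0x]] := variety_chart vX Xx.
set A := alg_gen iota _ in s0X s0x *; have hA : is_subalg iota A := alg_gen_subalg _ _.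
have [p pp xE] := s0x; have Ax := spec_sub hA s0x.
have [b [Ab pb bs]] : exists b, [/\ A b, ~ p b & forall a, a \in s -> A (b * a)].
  by apply: common_denominator pp _ => //; rewrite -xE.
have b0 := compl_prime_neq0 pp pb.
pose s1 := b^-1 :: s0; pose B := alg_gen iota [set` s1].
have hB : is_subalg iota B := alg_gen_subalg _ _.
have AB : A `<=` B.
  apply: sub_smallest2r => // a sa /=; rewrite inE; apply/orP; right.
  exact: sa.
have Bb : B b^-1 by apply: sub_gen_smallest => /=; rewrite mem_head.
have frac z : B z -> exists a b, [/\ A a, A b, b != 0, B b^-1 & z = a / b].
  (* The elements with a power of [b] as denominator already form an algebra containing the
     generators of [B]. *)
  suff : B `<=` [set z | exists2 n, A (z * b ^+ n) & True].
    move=> h /h [n Az _]; exists (z * b ^+ n), (b ^+ n); split=> //.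
    - exact: (subalgX _ hA).
    - exact: expf_neq0.
    - by rewrite -exprVn; apply: (subalgX _ hB).
    - by rewrite mulfK // expf_neq0.
  apply: smallest_sub.
    split=> [c|u v [n An _] [m Am _]|u v [n An _] [m Am _]].
    - by exists 0%N => //; rewrite mulr1; apply: subalg_scalar hA.
    - exists (n + m)%N => //; rewrite exprD mulrBl mulrA [b ^+ n * _]mulrC mulrA.
      by apply: (subalgB hA); apply: (subalgM hA) => //; apply: (subalgX _ hA).
    - by exists (n + m)%N => //; rewrite exprD mulrACA; apply: (subalgM hA).
  move=> w /=; rewrite inE => /orP[/eqP ->|sw].
    by exists 1%N => //; rewrite mulVf //; apply: subalg1 hA.
  by exists 0%N => //; rewrite mulr1; apply: sub_gen_smallest.
have BX : spec B `<=` X by move=> y /(spec_localization hA hB AB frac)/s0X.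
exists (spec B); split.
- by split; [apply: spec_zopen|exists s1].
- apply: (spec_open vX hB BX Xx); apply: smallest_sub.
    by case: (variety_local vX Xx).
  move=> z /=; rewrite inE => /orP[/eqP ->|sz]; last by apply: Ax; apply: sub_gen_smallest.
  by rewrite xE; apply: (localization_inv hA).
- move=> y sy; apply: sW; split; first exact: BX.
  move=> a /bs Aba; rewrite -(mulKf b0 a); apply: (spec_sub hB sy).
  by apply: (subalgM hB) => //; apply: AB.
Qed.

Lemma zopenT X : zopen X X.
Proof. by split=> // x Xx; exists [::]; split=> [a //|y []]. Qed.

Lemma zopen_trans X U W : zopen X U -> zopen U W -> zopen X W.
Proof.
move=> [UX hU] [WU hW]; split=> [x /WU/UX //|x Wx].
have [s [sx sU]] := hU _ (WU _ Wx); have [t [tx tW]] := hW _ Wx.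
exists (s ++ t); split=> [a|y [Xy sty]].
  by rewrite /= mem_cat => /orP[/sx|/tx].
have sy : [set` s] `<=` y by move=> a sa; apply: sty; rewrite /= mem_cat; apply/orP; left.
have ty : [set` t] `<=` y by move=> a ta; apply: sty; rewrite /= mem_cat; apply/orP; right.
by apply: tW; split=> //; apply: sU.
Qed.

Lemma zopen_inter X U W : zopen X U -> zopen X W -> zopen X (U `&` W).
Proof.
move=> hU [WX hW]; apply: (zopen_trans hU); split=> [x [] //|x [Ux Wx]].
have [s [sx sW]] := hW _ Wx; exists s; split=> // y [Uy sy]; split=> //.
by apply: sW; split=> //; case: hU => UX _; apply: UX.
Qed.

Lemma zopen_contains X U s : zopen X U -> zopen X [set y | U y /\ [set` s] `<=` y].
Proof.
move=> hU; apply: (zopen_trans hU); split=> [y [] //|y [Uy sy]].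
by exists s; split.
Qed.

Lemma zopen_generic X U x y : zopen X U -> U x -> X y -> x `<=` y -> U y.
Proof.
move=> [_ hU] Ux Xy xy; have [s [sx sU]] := hU _ Ux.
by apply: sU; split=> //; apply: subset_trans xy.
Qed.

Lemma prime_divisor_open X U Q : zopen X U -> prime_divisor U Q <->
  prime_divisor X Q /\ U Q.
Proof.
by move=> [UX _]; split=> [[UQ dQ]|[[XQ dQ] UQ]]; split=> //; split=> //; apply: UX.
Qed.

Lemma prime_divisor_dvr X P : is_normal_variety iota X -> prime_divisor X P ->
  is_dvr iota P.
Proof.
move=> [vX nX] [XP dP]; apply: dim_one_dvr dP; last exact: nX.
- exact: variety_local XP.
- exact: variety_noetherian XP.
- exact: variety_fractions XP.
Qed.

(** Algebraic Hartogs: [dvr_separates] finds, for [z] outside the local ring, a localization that is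
    a discrete valuation ring and excludes [z]; it is the generic point of a prime divisor through
    [x]. *)
Lemma regular_in_codim_one X x z : is_normal_variety iota X -> X x ->
  (forall Q, prime_divisor X Q -> x `<=` Q -> Q z) -> x z.
Proof.
move=> [vX nX] Xx h; apply: contrapT => xz; have [hx _] := variety_local vX Xx.
have [||q pq|q [pq dq qz]] := dvr_separates hx _ _ _ xz.
- exact: variety_noetherian Xx.
- exact: variety_fractions Xx.
- by apply: nX; apply: variety_localization.
apply: qz; apply: h; last exact: (sub_localization hx pq).
by split; [apply: variety_localization|apply: is_dvr_dim_one dq].
Qed.

(** The generic point of a prime divisor through [x] lies in every neighbourhood of [x], so orders
    on [W] decide regularity at [x]. *)
Lemma regular_of_ord_ge0 X W x z : is_normal_variety iota X -> zopen X W -> W x ->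
  z != 0 -> (forall Q, prime_divisor W Q -> 0 <= ord Q z) -> x z.
Proof.
move=> nX oW Wx z0 h; have Xx : X x by case: oW => WX _; apply: WX.
apply: (regular_in_codim_one nX Xx) => Q pQ xQ.
apply/(ord_ge0P (prime_divisor_dvr nX pQ) z0); apply: h; apply/(prime_divisor_open _ oW).
by split=> //; apply: (zopen_generic oW Wx) xQ; case: pQ.
Qed.

(** On each of the finitely many charts write [a = b / c]: a divisor where the order is nonzero
    comes from a prime of height one containing [b] or [c]. *)
Lemma finite_div X a : is_normal_variety iota X -> a != 0 ->
  finite_set [set P | prime_divisor X P /\ ord P a != 0].
Proof.
move=> nX a0; have [vX _] := nX; have [_ [charts [ch XE]] _] := vX.
pose D s := [set P | [/\ prime_divisor X P, spec (alg_gen iota [set` s]) P & ord P a != 0]].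
apply: (@sub_finite_set _ _ (\bigcup_(s in [set` charts]) D s)).
  move=> P [pP oP]; case: (pP) => XP _; move: XP; rewrite {1}XE => -[s cs sP].
  by exists s.
apply: bigcup_finite => [|s cs]; first exact: finite_seq.
set A := alg_gen iota [set` s] in D *; have hA : is_subalg iota A := alg_gen_subalg _ _.
have nA : noetherian A := @noetherian_alg_gen _ _ _ _.
have [b [c [Ab Ac c0 aE]]] := ch s cs a.
have b0 : b != 0 by apply: contra_neq a0 => bE; rewrite aE bE mul0r.
pose Z b := [set p | [/\ is_prime_ideal A p, dim_one (localization A p) & p b]].
apply: (@sub_finite_set _ _ (localization A @` (Z b `|` Z c))); last first.
  by apply: finite_image; rewrite finite_setU; split; apply: (finite_dim_one_primes hA nA).
move=> P [pP sP]; have dP := prime_divisor_dvr nX pP.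
have [p pp PE] := sP; have [_ dimP] := pP => oP.
have ordA d : A d -> d != 0 -> ord P d != 0 -> Z d p.
  move=> Ad d0 od; split=> //; first by rewrite -PE.
  have : max_ideal P d.
    apply: contrapT => nd; move: od.
    by rewrite (ord_unit dP (not_max_unit (spec_sub hA sP Ad) nd)).
  by move=> md; rewrite -(localization_maxA hA pp) -PE.
exists p => //; apply: contrapT => /not_orP[nb nc].
have [ob oc] : ord P b = 0 /\ ord P c = 0.
  split; apply/eqP; apply: contrapT => /negP h; [apply: nb|apply: nc]; exact: ordA.
have c0' : c^-1 != 0 by rewrite invr_eq0.
by move/eqP: oP; apply; rewrite aE (ordM dP b0 c0') (ordV dP c0) ob oc.
Qed.

Lemma center_unique X P x y : is_variety iota X -> is_dvr iota P -> X x -> X y ->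
  dominates P x -> dominates P y -> x = y.
Proof. by move=> [_ _ sep] /is_dvr_valuation; apply: sep. Qed.

(** An open set meeting the closure of a point contains that point. This turns the conditions on [U]
    in both suprema into [U x]. *)
Lemma open_meets_center X U P x : is_variety iota X -> is_dvr iota P -> X x ->
  dominates P x -> zopen X U -> (U `&` center X P !=set0) <-> U x.
Proof.
move=> vX dP Xx Px oU; split=> [[z [Uz [y [Xy Py [Xz]]]]]|Ux].
  by move/(_ _ oU Uz); rewrite (center_unique vX dP Xx Xy Px Py).
by exists x; split=> //; exists x; split=> //; split.
Qed.

(* Multiply nonzero elements of the primes at which N does not vanish. *)
Lemma bounding_function A (N : set K -> nat) : is_subalg iota A ->
  (forall Q, spec A Q -> dim_one Q -> is_dvr iota Q) ->
  finite_set [set Q | N Q != 0%N] ->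
  exists h, [/\ A h, h != 0 &
    forall Q, spec A Q -> dim_one Q -> (N Q)%:Z <= ord Q h].
Proof.
move=> hA dvrA /finite_seqP[l lE].
have [h [Ah h0 hl]] : exists h, [/\ A h, h != 0 &
    forall Q, Q \in l -> spec A Q -> dim_one Q -> (N Q)%:Z <= ord Q h].
  elim: l {lE} => [|Q0 l [h [Ah h0 hl]]].
    by exists 1; split; rewrite ?oner_eq0 //; apply: subalg1 hA.
  case: (pselect (spec A Q0 /\ dim_one Q0)) => [[sQ0 dQ0]|nQ0]; last first.
    exists h; split=> // Q; rewrite inE => /orP[/eqP ->|]; last exact: hl.
    by move=> sQ0 dQ0; case: nQ0.
  have [p pp Q0E] := sQ0; have DQ0 := dvrA _ sQ0 dQ0.
  have [b pb b0] : exists2 b, p b & b != 0.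
    apply: contrapT => hno; case: dQ0 => m0 _; apply: m0.
    rewrite Q0E (localization_max pp) eqEsubset; split=> [_ [a [b [pa _ _ ->]]]|_ ->] /=.
      case: (eqVneq a 0) => [->|a0]; first by rewrite mul0r.
      by case: hno; exists a.
    exists 0, 1; rewrite mul0r; split=> //; [by case: pp => [[]]|exact: subalg1 hA|by case: pp].
  have Ab := prime_ideal_sub pp pb.
  exists (h * b ^+ N Q0); split; first by apply: (subalgM hA) => //; apply: (subalgX _ hA).
    by rewrite mulf_neq0 // expf_neq0.
  move=> Q Ql sQ dQ; have DQ := dvrA _ sQ dQ; have AQ := spec_sub hA sQ.
  have bN0 : b ^+ N Q0 != 0 by rewrite expf_neq0.
  have oh : 0 <= ord Q h by apply/(ord_ge0P DQ) => //; apply: AQ.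
  have ob : 0 <= ord Q b by apply/(ord_ge0P DQ) => //; apply: AQ.
  rewrite (ordM DQ) // (ordX _ DQ) //; move: Ql; rewrite inE => /orP[/eqP QE|Ql]; last first.
    by rewrite ler_wpDr ?hl // mulr_ge0.
  have ob1 : 1 <= ord Q b.
    rewrite -gtz0_ge1; apply/(ord_gt0P DQ) => //.
    by rewrite QE Q0E; have := pb; rewrite -{1}(localization_maxA hA pp) => -[].
  by rewrite ler_wpDl // QE -{1}[(N Q0)%:Z]mulr1 ler_wpM2l // -QE.
exists h; split=> // Q sQ dQ; case: (boolP (Q \in l)) => [Ql|nQl]; first exact: hl.
have -> : N Q = 0%N.
  apply: contrapT => /eqP NQ; move/negP: nQl; apply.
  by have : [set` l] Q by rewrite -lE.
by apply/(ord_ge0P (dvrA _ sQ dQ)) => //; apply: (spec_sub hA sQ).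
Qed.

End VarietyPoints.

(** * Envelopes, pullbacks and discrepancies *)

Section EnvelopesAndDiscrepancies.
Variables (R : realType) (k K : fieldType) (iota : {rmorphism k -> K}).
Implicit Types (X Y U W : set (set K)) (P Q V x y : set K) (N B E : set K -> R).
Implicit Types (s t : seq K) (m n : nat).

(** This is how rounding errors disappear: [c] is independent of [m], so the error is negligible
    after division by [m]. *)
Lemma le_of_scaled_le (a b c : R) :
  (forall m, (0 < m)%N -> m%:R * a <= m%:R * b + c) -> a <= b.
Proof.
move=> h; rewrite leNgt; apply/negP => ba.
have d0 : 0 < a - b by rewrite subr_gt0.
pose m := (Num.bound (`|c| / (a - b))).+1.
have mc : `|c| < m%:R * (a - b).
  rewrite -ltr_pdivrMr //; apply: (lt_trans (archi_boundP _)).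
    by rewrite divr_ge0 // ltW.
  by rewrite ltr_nat.
have := h m isT; rewrite -lerBlDl -mulrBr leNgt => /negP; apply.
exact: le_lt_trans (ler_norm c) mc.
Qed.

Lemma ord_div_le V a b : is_dvr iota V -> a != 0 -> b != 0 -> V a -> V b ->
  `|ord V (a / b)| <= ord V (a * b).
Proof.
move=> dV a0 b0 Va Vb; have b0' : b^-1 != 0 by rewrite invr_eq0.
rewrite (ordM dV a0 b0') (ordM dV a0 b0) (ordV dV b0).
have /(ord_ge0P dV a0) oa := Va; have /(ord_ge0P dV b0) ob := Vb.
by rewrite (le_trans (ler_normB _ _)) // !ger0_norm.
Qed.

(* phi m is the product of h = \prod_i a_i b_i and of the powers of the psi i
   with exponents the integral parts of m * r i: on every valuation ring
   containing the a_i and b_i, the order of h exceeds the rounding errors. *)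
Lemma rounded_product x n (psi : 'I_n -> K) (r : 'I_n -> R) :
  has_fraction_field x -> (forall i, psi i != 0) ->
  exists t h (phi : nat -> K), [/\ [set` t] `<=` x, forall m, phi m != 0 &
    forall V, is_dvr iota V -> [set` t] `<=` V -> forall m,
      m%:R * (\sum_i r i * (ord V (psi i))%:~R) <= (ord V (phi m))%:~R :> R /\
      (ord V (phi m))%:~R <=
        m%:R * (\sum_i r i * (ord V (psi i))%:~R) + 2%:R * (ord V h)%:~R :> R].
Proof.
move=> fx psi0.
have /choice[ab abE] : forall i, exists ab : K * K,
    [/\ x ab.1, x ab.2, ab.1 != 0, ab.2 != 0 & psi i = ab.1 / ab.2].
  move=> i; have [a [b [xa xb b0 pE]]] := fx (psi i); exists (a, b); split=> //=.
  by apply: contra_neq (psi0 i) => aE; rewrite pE aE mul0r.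
pose t := [seq (ab i).1 | i <- enum 'I_n] ++ [seq (ab i).2 | i <- enum 'I_n].
have tP V : [set` t] `<=` V -> forall i, V (ab i).1 /\ V (ab i).2.
  move=> tV i; split; apply: tV; rewrite /= mem_cat.
    by rewrite (map_f (fun i => (ab i).1)) ?mem_enum.
  by rewrite orbC (map_f (fun i => (ab i).2)) ?mem_enum.
pose c i := (ab i).1 * (ab i).2.
have c0 i : c i != 0 by case: (abE i) => _ _ a0 b0 _; rewrite mulf_neq0.
pose e m i := Num.floor (m%:R * r i).
pose h := \prod_(i < n) c i.
pose phi m := (\prod_(i < n) psi i ^ e m i) * h.
exists t, h, phi.
have psie0 m i : psi i ^ e m i != 0 by rewrite expfz_neq0.
split=> [a|m|V dV tV m].
- rewrite /= mem_cat => /orP[] /mapP[i _ ->]; by case: (abE i).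
- by rewrite mulf_neq0 //; apply/prodf_neq0.
have [p0 pE] := ord_prod (index_enum 'I_n) dV (psie0 m).
have [h0 hE] := ord_prod (index_enum 'I_n) dV c0.
rewrite (ordM dV p0 h0) pE hE.
set S := \sum_i r i * _; set C : int := \sum_(i <- _) ord V (c i).
(* Each floor errs by at most 1 and [ord_div_le] bounds the order of [psi i] by that of [c i], so
   the total error is at most [ord V h]. Multiplying by [h] shifts it to the range from 0 to twice
   [ord V h], whence the factor 2. *)
have main : `|(\sum_i ord V (psi i ^ e m i))%:~R - m%:R * S| <= C%:~R :> R.
  rewrite /S mulr_sumr rmorph_sum -sumrB rmorph_sum.
  apply: (le_trans (ler_norm_sum _ _ _)); apply: ler_sum => i _.
  rewrite (ordXz _ dV (psi0 i)) rmorphM /= mulrA -mulrBl normrM.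
  have fl : `|(e m i)%:~R - m%:R * r i| <= 1.
    rewrite distrC ger0_norm ?subr_ge0 ?floor_le // lerBlDl ltW //.
    by have := floorD1_gt (m%:R * r i); rewrite rmorphD.
  apply: (le_trans (ler_wpM2r (normr_ge0 _) fl)); rewrite mul1r.
  rewrite -intr_norm ler_int; have [Va Vb] := tP _ tV i.
  by case: (abE i) => _ _ a0 b0 ->; apply: ord_div_le.
have [lo hi] : m%:R * S - C%:~R <= (\sum_i ord V (psi i ^ e m i))%:~R /\
    (\sum_i ord V (psi i ^ e m i))%:~R <= m%:R * S + C%:~R.
  by move: main; rewrite ler_distl => /andP[].
rewrite rmorphD /=; split; first by rewrite -lerBlDr.
by rewrite [2%:R * _]mulr_natl mulr2n addrA lerD2r.
Qed.

Lemma zopen_inter_fin X x n (W : 'I_n -> set (set K)) : X x ->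
  (forall i, zopen X (W i) /\ W i x) ->
  exists W', [/\ zopen X W', W' x & forall i, W' `<=` W i].
Proof.
move=> Xx hW.
have [W' [oW' W'x sub]] : exists W', [/\ zopen X W', W' x &
    forall i, i \in enum 'I_n -> W' `<=` W i].
  elim: (enum 'I_n) => [|i l [W' [oW' W'x sub]]].
    by exists X; split=> //; apply: zopenT.
  have [oWi Wix] := hW i; exists (W i `&` W'); split=> //; first exact: zopen_inter.
  move=> j; rewrite inE => /orP[/eqP -> z []//|/sub lj z [_ /lj]//].
by exists W'; split=> // i; apply: sub; rewrite mem_enum.
Qed.

(** * Germs of sections at the image of the generic point of P *)

Section AtPoint.
Variables (X : set (set K)) (x P : set K).
Hypotheses (nX : is_normal_variety iota X) (Xx : X x) (dP : is_dvr iota P)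
  (Px : dominates P x).

Let vX : is_variety iota X. Proof. by case: nX. Qed.

(** [C] and [W'] precede the quantifier on [m]: [W'] is the part of [W] where the numerators and
    denominators of the [psi i] are regular. The same functions lie in [x], hence in [P], so the
    estimate holds at [P] too. *)
Lemma rounded_section W n (psi : 'I_n -> K) (r : 'I_n -> R) :
  zopen X W -> W x -> (forall i, psi i != 0) ->
  exists (C : R) (phi : nat -> K) W', [/\ zopen X W', W' x, W' `<=` W &
    forall m, [/\ phi m != 0,
      forall Q, prime_divisor W' Q ->
        m%:R * (\sum_i r i * (ord Q (psi i))%:~R) <= (ord Q (phi m))%:~R :> R &
      (ord P (phi m))%:~R <= m%:R * (\sum_i r i * (ord P (psi i))%:~R) + C]].
Proof.
move=> oW Wx psi0.
have [t [h [phi [tx phi0 hphi]]]] := rounded_product r (variety_fractions vX Xx) psi0.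
exists (2%:R * (ord P h)%:~R), phi, [set y | W y /\ [set` t] `<=` y]; split=> //.
- exact: zopen_contains.
- by move=> y [].
move=> m; split=> // [Q pQ|].
  have /(prime_divisor_open _ (zopen_contains t oW))[pXQ [_ tQ]] := pQ.
  by case: (hphi Q (prime_divisor_dvr nX pXQ) tQ m).
have tP : [set` t] `<=` P by apply: subset_trans tx _; case: Px.
by case: (hphi P dP tP m).
Qed.

(** The rounded products have nonnegative order in codimension one, so they are regular at [x] and
    have nonnegative order at [P]; divide by [m]. Real coefficients forbid arguing with a single
    function. *)
Lemma effective_pullback W n (psi : 'I_n -> K) (r : 'I_n -> R) :
  zopen X W -> W x -> (forall i, psi i != 0) ->
  (forall Q, prime_divisor W Q -> 0 <= \sum_i r i * (ord Q (psi i))%:~R) ->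
  0 <= \sum_i r i * (ord P (psi i))%:~R.
Proof.
move=> oW Wx psi0 pos.
have [C [phi [W' [oW' W'x W'W hphi]]]] := rounded_section r oW Wx psi0.
apply: (@le_of_scaled_le _ _ C) => m _; have [phi0 ophi] := hphi m.
rewrite mulr0; apply: le_trans; rewrite ler0z; apply/(ord_ge0P dP phi0).
case: Px => xP _; apply: xP; apply: (regular_of_ord_ge0 nX oW' W'x phi0) => Q pQ.
rewrite -(ler0z R); apply: le_trans (ophi Q pQ).
rewrite mulr_ge0 // pos //; have /(prime_divisor_open _ oW')[pXQ W'Q] := pQ.
by apply/(prime_divisor_open _ oW); split=> //; apply: W'W.
Qed.

Definition sections N : set K := [set phi | phi != 0 /\ exists W,
  [/\ zopen X W, W x & divisorial_sections N W phi]].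

(** The supremum of this set of reals is the coefficient of the envelope ([env_coeffE]) and, for
    [N = - (KX + Delta)] and after adding [KY P], the discrepancy ([discrepancyE]). *)
Definition slopes N : set R := [set e | exists m phi,
  [/\ (0 < m)%N, sections (fun Q => m%:R * N Q) phi &
      e = - m%:R^-1 * (ord P phi)%:~R]].

Lemma ord_divisorialE N :
  ord_divisorial X N P = ereal_inf [set ((ord P phi)%:~R)%:E | phi in sections N].
Proof.
congr ereal_inf; rewrite eqEsubset; split=> [_ [U [phi [oU Uc sphi phi0 ->]]]|].
  exists phi => //; split=> //; exists U; split=> //.
  exact/(open_meets_center vX dP Xx Px oU).
move=> _ [phi [phi0 [U [oU Ux sphi]]] <-]; exists U, phi; split=> //.
exact/(open_meets_center vX dP Xx Px oU).
Qed.

(** The factor [- m^-1] turns the infimum over sections into a supremum, and the two suprema merge.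
    The hypotheses keep the result among the reals. *)
Lemma env_coeffE N : slopes N !=set0 -> has_ubound (slopes N) ->
  env_coeff X N P = (sup (slopes N))%:E.
Proof.
move=> ne ub.
have lb m : (0 < m)%N -> ((- m%:R * sup (slopes N))%:E <=
    ord_divisorial X (fun Q => m%:R * N Q)%R P)%E.
  move=> m0; rewrite ord_divisorialE; apply: le_ereal_inf_tmp => _ [phi sphi <-].
  have mR : 0 < m%:R :> R by rewrite ltr0n.
  rewrite lee_fin mulNr lerNl -ler_pdivrMl // mulrN -mulNr.
  by apply: ub_le_sup => //; exists m, phi.
apply/eqP; rewrite eq_le; apply/andP; split.
  apply: ge_ereal_sup => _ [m m0 ->]; have := lb m m0.
  have mR : 0 < m%:R :> R by rewrite ltr0n.
  (* [+oo], the infimum when there is no nonzero section, contributes [-oo] to the supremum; [-oo]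
     is excluded by [lb]. *)
  case: ord_divisorial => [i|_|]; last by rewrite leeNy_eq.
    rewrite -EFinM !lee_fin => hi.
    by rewrite mulNr lerNl ler_pdivlMl // mulrN -mulNr.
  by rewrite mulry ltr0_sg ?oppr_lt0 ?invr_gt0 // mulN1e leNye.
have [d dE] : exists d, env_coeff X N P = d by eexists.
suff : forall e, slopes N e -> (e%:E <= d)%E.
  rewrite dE; case: (d) => [d' hd| |hd].
  - by rewrite lee_fin; apply: ge_sup => // e /hd; rewrite lee_fin.
  - by rewrite leey.
  - by have [e /hd] := ne; rewrite leeNy_eq.
move=> _ [m [phi [m0 sphi ->]]]; rewrite -dE.
have mR : 0 < m%:R :> R by rewrite ltr0n.
apply: (@le_trans _ _ ((- m%:R^-1)%:E * ord_divisorial X (fun Q => m%:R * N Q)%R P)%E);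
  last by apply: ereal_sup_ubound; exists m.
have : (ord_divisorial X (fun Q => m%:R * N Q)%R P <= ((ord P phi)%:~R)%:E)%E.
  by rewrite ord_divisorialE; apply: ereal_inf_lbound; exists phi.
have := lb m m0; case: ord_divisorial => [i _| |].
- by rewrite -EFinM !lee_fin => hi; rewrite !mulNr lerN2 ler_pM2l ?invr_gt0.
- by rewrite leye_eq.
- by rewrite leeNy_eq.
Qed.

Lemma divisorial_section_slopes N m phi W : (0 < m)%N -> zopen X W -> W x ->
  phi != 0 ->
  (forall Q, prime_divisor W Q -> - (m%:R * N Q) <= (ord Q phi)%:~R) ->
  slopes N (- m%:R^-1 * (ord P phi)%:~R).
Proof.
move=> m0 oW Wx phi0 h; exists m, phi; split=> //; split=> //; exists W; split=> //.
by right=> Q pQ; rewrite -lerBlDr sub0r; apply: h.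
Qed.

(** [h] is itself a section of the sheaf of [N], which bounds the supremum below; and for a section
    [phi] of the sheaf of [m N] the product [phi * h ^+ m] is regular at [x], which bounds it
    above. *)
Lemma slopes_bounds N h W : zopen X W -> W x -> h != 0 ->
  (forall Q, prime_divisor W Q -> `|N Q| <= (ord Q h)%:~R) ->
  [/\ slopes N !=set0, has_ubound (slopes N) &
      `|sup (slopes N)| <= (ord P h)%:~R].
Proof.
move=> oW Wx h0 hN.
have low : slopes N (- (ord P h)%:~R).
  have -> : - (ord P h)%:~R = - 1%:R^-1 * (ord P h)%:~R :> R by rewrite invr1 mulN1r.
  apply: (divisorial_section_slopes _ oW Wx h0) => // Q pQ.
  by rewrite mul1r (le_trans _ (hN Q pQ)) // -normrN ler_norm.
have up : ubound (slopes N) (ord P h)%:~R.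
  move=> _ [m [phi [m0 [phi0 [W' [oW' W'x sphi]]] ->]]].
  have mR : 0 < m%:R :> R by rewrite ltr0n.
  rewrite mulNr lerNl ler_pdivlMl // mulrN -subr_ge0 opprK.
  have hm0 : h ^+ m != 0 by rewrite expf_neq0.
  have -> : (ord P phi)%:~R + m%:R * (ord P h)%:~R = (ord P (phi * h ^+ m))%:~R :> R.
    by rewrite (ordM dP phi0 hm0) (ordX _ dP h0) rmorphD rmorphM.
  have p0 : phi * h ^+ m != 0 by rewrite mulf_neq0.
  rewrite ler0z; apply/(ord_ge0P dP p0); case: Px => xP _; apply: xP.
  apply: (regular_of_ord_ge0 nX (zopen_inter oW oW') _ p0) => // Q.
  move/(prime_divisor_open _ (zopen_inter oW oW')) => [pQ [WQ W'Q]].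
  have dQ := prime_divisor_dvr nX pQ.
  have pWQ : prime_divisor W Q by apply/(prime_divisor_open _ oW).
  have pW'Q : prime_divisor W' Q by apply/(prime_divisor_open _ oW').
  rewrite (ordM dQ phi0 hm0) (ordX _ dQ h0) -(ler0z R) rmorphD rmorphM /=.
  case: sphi => [phiE|/(_ Q pW'Q)]; first by rewrite phiE eqxx in phi0.
  move=> /le_trans; apply; rewrite lerD2l ler_wpM2l // ?ler0n //.
  exact: le_trans (ler_norm _) (hN Q pWQ).
have ne : slopes N !=set0 by eexists; exact: low.
have ub : has_ubound (slopes N) by eexists; exact: up.
split=> //; rewrite ler_norml; apply/andP; split; first exact: ub_le_sup.
exact: ge_sup.
Qed.

Lemma local_equation_ord U F y phi : zopen X U -> local_equation (R := R) U F y phi ->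
  exists W, [/\ zopen X W, W y, W `<=` U &
    forall Q, prime_divisor W Q -> F Q = (ord Q phi)%:~R].
Proof.
move=> oU [phi0 [W [oW Wy FE]]]; have WU : W `<=` U by case: oW.
exists W; split=> //; first exact: zopen_trans oW.
move=> Q pQ; have := congr1 (@^~ Q) FE; rewrite /restr /div_fun /patch.
by rewrite (mem_set pQ) (_ : Q \in W = true) //; apply: mem_set; case: pQ.
Qed.

(** The selected decomposition is unknown, hence the existential. R-Cartierness and [U x] make the
    set under [xget] nonempty, so its default value 0 does not intervene, and separatedness puts the
    selected centre at [x]. *)
Lemma pullback_coeff_rep U E : zopen X U -> U x -> R_cartier U E ->
  exists n (psi : 'I_n -> K) (r : 'I_n -> R) W,
  [/\ forall i, psi i != 0, zopen X W /\ W x, W `<=` U,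
      forall Q, prime_divisor W Q -> E Q = \sum_i r i * (ord Q (psi i))%:~R &
      pullback_coeff U E P = \sum_i r i * (ord P (psi i))%:~R].
Proof.
move=> oU Ux [n0 [r0 [F0 dec0]]].
have [n [r [F [phi [y [dec Uy Py eqs ->]]]]]] : [set c | exists n (r : 'I_n -> R) F
    (phi : 'I_n -> K) y, [/\ cartier_decomposition U E r F, U y, dominates P y,
      forall i, local_equation U (F i) y (phi i) &
      c = \sum_(i < n) r i * (ord P (phi i))%:~R]] (pullback_coeff U E P).
  apply: xgetPex; have /choice[phi hphi] : forall i, exists phi, local_equation U (F0 i) x phi.
    by move=> i; have [/(_ i)[_ h] _] := dec0; apply: h.
  by exists (\sum_(i < n0) r0 i * (ord P (phi i))%:~R), n0, r0, F0, phi, x.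
have yx : y = x by apply: (center_unique vX dP) => //; case: oU => UX _; apply: UX.
subst y; have /choice[W hW] := fun i => local_equation_ord oU (eqs i).
have [|W' [oW' W'x sub]] := zopen_inter_fin Xx (W := fun i => W i).
  by move=> i; case: (hW i).
exists n, phi, r, (U `&` W'); split=> //.
- by move=> i; case: (eqs i).
- by split; [apply: zopen_inter|split].
- move=> Q /(prime_divisor_open _ (zopen_inter oU oW')) [pQ [UQ W'Q]].
  have [_ ->] := dec; apply: eq_bigr => i _; congr (_ * _).
  have [oWi _ _ h] := hW i; apply: h; apply/(prime_divisor_open _ oWi).
  by split=> //; apply: sub.
Qed.

Lemma slopes_pullback N U E : zopen X U -> U x -> R_cartier U E ->
  has_ubound (slopes N) -> (forall Q, prime_divisor U Q -> - N Q <= E Q) ->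
  - pullback_coeff U E P <= sup (slopes N).
Proof.
move=> oU Ux cE ub NE.
have [n [psi [r [W [psi0 [oW Wx] WU EE ->]]]]] := pullback_coeff_rep oU Ux cE.
have [C [phi [W' [oW' W'x W'W hphi]]]] := rounded_section r oW Wx psi0.
rewrite lerNl; apply: (@le_of_scaled_le _ _ C) => m m0.
have [phi0 ophi oP] := hphi m; apply: le_trans oP.
have mR : 0 < m%:R :> R by rewrite ltr0n.
rewrite mulrN lerNl -ler_pdivrMl // mulrN -mulNr; apply: ub_le_sup => //.
apply: (divisorial_section_slopes m0 oW' W'x phi0) => Q pQ.
apply: le_trans (ophi Q pQ); rewrite -mulrN ler_wpM2l ?ler0n //.
have /(prime_divisor_open _ oW')[pXQ W'Q] := pQ.
have WQ := W'W _ W'Q; rewrite -EE; last by apply/(prime_divisor_open _ oW).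
by apply: NE; apply/(prime_divisor_open _ oU); split=> //; apply: WU.
Qed.

Lemma div_fun_ord U phi Q : prime_divisor U Q -> div_fun R U phi Q = (ord Q phi)%:~R.
Proof. by move=> pQ; rewrite /div_fun /patch mem_set. Qed.

Lemma div_fun_out U phi Q : ~ prime_divisor U Q -> div_fun R U phi Q = 0.
Proof. by move=> pQ; rewrite /div_fun /patch memNset. Qed.

Lemma div_fun_cartier U phi : zopen X U -> phi != 0 -> cartier U (div_fun R U phi).
Proof.
move=> oU phi0; split.
  split; last by move=> Q /=; apply: contraPP => /div_fun_out -> /eqP.
  apply: sub_finite_set (finite_div nX phi0) => Q /= dQ.
  have pQ : prime_divisor U Q by apply: contraPP dQ => /div_fun_out -> /eqP.
  have /(prime_divisor_open _ oU)[pXQ _] := pQ.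
  by split=> //; move: dQ; rewrite div_fun_ord // intr_eq0.
move=> y Uy; exists phi; split=> //; exists U; split=> //; first exact: zopenT.
apply/funext => Q; rewrite /restr /patch; case: ifPn => // /negP UQ.
by rewrite div_fun_out // => -[UQ' _]; apply: UQ; apply: mem_set.
Qed.

(** Adjoin [phi] with coefficient [c] to the selected equations, taken with coefficients [- r j]:
    the combination has order zero along every prime divisor of [W], and [effective_pullback] gives
    the inequality. *)
Lemma pullback_coeff_div U phi (c : R) : zopen X U -> U x -> phi != 0 ->
  pullback_coeff U (fun Q => c * div_fun R U phi Q) P <= c * (ord P phi)%:~R.
Proof.
move=> oU Ux phi0.
have cE : R_cartier U (fun Q => c * div_fun R U phi Q).
  exists 1%N, (fun=> c), (fun=> div_fun R U phi); split=> [_|].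
    exact: div_fun_cartier.
  by apply/funext => Q; rewrite big_ord1.
have [n [psi [r [W [psi0 [oW Wx] WU EE ->]]]]] := pullback_coeff_rep oU Ux cE.
pose psi' i := if unlift ord0 i is Some j then psi j else phi.
pose r' (i : 'I_n.+1) := if unlift ord0 i is Some j then - r j else c.
have sumE Q : \sum_i r' i * (ord Q (psi' i))%:~R =
    c * (ord Q phi)%:~R - \sum_i r i * (ord Q (psi i))%:~R.
  rewrite big_ord_recl /r' /psi' unlift_none -sumrN; congr (_ + _).
  by apply: eq_bigr => i _; rewrite liftK mulNr.
rewrite -subr_ge0 -sumE; apply: (effective_pullback oW Wx) => [i|Q pQ].
  by rewrite /psi'; case: unliftP.
rewrite sumE -EE // div_fun_ord ?subrr //.
have /(prime_divisor_open _ oW)[pXQ WQ] := pQ.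
by apply/(prime_divisor_open _ oU); split=> //; apply: WU.
Qed.

Lemma discrepancyE Y KX KY Delta : Y P -> is_divisor X KX -> is_divisor X Delta ->
  let N Q := - (KX Q + Delta Q) in
  slopes N !=set0 -> has_ubound (slopes N) ->
  discrepancy iota X Y KX KY Delta P = (KY P + sup (slopes N))%:E.
Proof.
move=> YP [finK KX0] [finD D0] N ne ub.
have KYP U : U x -> restr (preimage_open Y U) KY P = KY P.
  move=> Ux; rewrite /restr /patch mem_set //; split=> //; exists x => //.
have restrE U D Q : U Q -> restr U D Q = D Q :> R.
  by move=> UQ; rewrite /restr /patch mem_set.
apply/eqP; rewrite eq_le; apply/andP; split.
  apply: ge_ereal_sup => _ [U [B [[oU _] Uc hB [B0 cE] ->]]].
  have Ux : U x by apply/(open_meets_center vX dP Xx Px oU).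
  rewrite lee_fin /discrepancy_on KYP // lerD2l.
  (* As [B] is effective, [KX + Delta + B] is at least [- N], so rounding its equations gives
     sections of the multiples of [N]. *)
  apply: slopes_pullback => // Q [UQ _]; rewrite !restrE // opprK lerDl; exact: B0.
have [d dE] : exists d, discrepancy iota X Y KX KY Delta P = d by eexists.
suff : forall e, slopes N e -> ((KY P + e)%:E <= d)%E.
  rewrite dE; case: (d) => [d' hd| |hd].
  - rewrite lee_fin -lerBrDl; apply: ge_sup => // e /hd.
    by rewrite lee_fin -lerBrDl.
  - by rewrite leey.
  - by have [e /hd] := ne; rewrite leeNy_eq.
move=> _ [m [phi [m0 [phi0 [W [oW Wx sphi]]] ->]]].
have mR : 0 < m%:R :> R by rewrite ltr0n.
(* Sections are taken on arbitrary open sets, whereas the discrepancy runs over affine ones. *)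
have [U [aU Ux UW]] := affine_open_nbhs vX oW Wx; have [oU _] := aU.
pose E Q := m%:R^-1 * div_fun R U phi Q.
pose B Q := E Q - (restr U KX Q + restr U Delta Q).
have BE : (fun Q => restr U KX Q + restr U Delta Q + B Q) = E.
  by apply/funext => Q; rewrite /B addrC subrK.
have restr_out D Q : [set Q | D Q != 0] `<=` prime_divisor X ->
    ~ prime_divisor U Q -> restr U D Q = 0 :> R.
  move=> hD npQ; rewrite /restr /patch; case: ifPn => // /set_mem UQ.
  apply: contrapT => /eqP DQ; apply: npQ; apply/(prime_divisor_open _ oU).
  by split=> //; apply: hD.
(* A divisor is a function supported on prime divisors, so the difference defining [B] has to vanish
   elsewhere. *)
have Bout Q : ~ prime_divisor U Q -> B Q = 0.
  by move=> npQ; rewrite /B /E div_fun_out // !restr_out // mulr0 addr0 subr0.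
have [[[finphi _] _] cE] : cartier U (div_fun R U phi) /\ R_cartier U E.
  have hc := div_fun_cartier oU phi0; split=> //.
  exists 1%N, (fun=> m%:R^-1), (fun=> div_fun R U phi); split=> // .
  by apply/funext => Q; rewrite big_ord1.
apply: (@le_trans _ _ (discrepancy_on Y KX KY Delta P U B)%:E).
  rewrite lee_fin /discrepancy_on KYP // BE lerD2l mulNr lerN2.
  exact: pullback_coeff_div.
rewrite -dE; apply: ereal_sup_ubound; exists U, B; split=> //.
- exact/(open_meets_center vX dP Xx Px oU).
- split; last by move=> Q /= BQ; apply: contrapT => /Bout BQ0; rewrite BQ0 eqxx in BQ.
  apply: (@sub_finite_set _ _ ([set Q | div_fun R U phi Q != 0] `|`
    ([set Q | KX Q != 0] `|` [set Q | Delta Q != 0]))); last by rewrite !finite_setU.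
  move=> Q /= BQ; apply: contrapT => /not_orP[/negP/negPn/eqP h1 /not_orP].
  move=> [/negP/negPn/eqP h2 /negP/negPn/eqP h3]; move/eqP: BQ; apply.
  by rewrite /B /E h1 /restr /patch h2 h3 !if_same mulr0 addr0 subr0.
- split; last by rewrite BE.
  move=> Q; case: (pselect (prime_divisor U Q)) => [pQ|/Bout -> //].
  have /(prime_divisor_open _ oU)[pXQ UQ] := pQ.
  have pWQ : prime_divisor W Q by apply/(prime_divisor_open _ oW); split=> //; apply: UW.
  rewrite /B /E div_fun_ord // !restrE // subr_ge0 ler_pdivlMl //.
  case: sphi => [phiE|/(_ Q pWQ)]; first by rewrite phiE eqxx in phi0.
  by rewrite /N mulrN subr_ge0.
Qed.

End AtPoint.

(** One function per chart. That the list is finite gives finiteness on [Y]: a nonzero envelope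
    coefficient forces a nonzero order of some member, and each member has a finite divisor
    there. *)
Lemma variety_bounding_functions X N : is_normal_variety iota X -> is_divisor X N ->
  exists hs : seq K, all (fun h => h != 0) hs /\
    forall x, X x -> exists h U, [/\ h \in hs, zopen X U, U x &
      forall Q, prime_divisor U Q -> `|N Q| <= (ord Q h)%:~R].
Proof.
move=> nX [finN _]; have [vX _] := nX; have [_ [charts [ch XE]] _] := vX.
(* The separate value at zero gives [bnd] the finite support that [bounding_function] demands. *)
pose bnd Q := if N Q == 0 then 0%N else Num.bound `|N Q|.
have bndP Q : `|N Q| <= (bnd Q)%:R.
  rewrite /bnd; case: eqP => [->|_]; first by rewrite normr0.
  by apply/ltW/archi_boundP.
have finb : finite_set [set Q | bnd Q != 0%N].
  by apply: sub_finite_set finN => Q; apply: contra_neq => NQ; rewrite /bnd NQ eqxx.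
have /choice[h hP] : forall s, exists h, s \in charts -> h != 0 /\
    forall Q, spec (alg_gen iota [set` s]) Q -> dim_one Q -> `|N Q| <= (ord Q h)%:~R.
  move=> s; case: (boolP (s \in charts)) => cs; last by exists 0.
  have [|h [_ h0 hQ]] := bounding_function (alg_gen_subalg iota [set` s]) _ finb.
    move=> Q sQ dQ; apply: (prime_divisor_dvr nX); split=> //.
    by rewrite XE; exists s.
  exists h => _; split=> // Q sQ dQ; apply: le_trans (bndP Q) _.
  by rewrite -[(bnd Q)%:R]/((bnd Q)%:Z%:~R) ler_int hQ.
exists [seq h s | s <- charts]; split.
  by apply/allP => _ /mapP[s cs ->]; case: (hP s cs).
move=> x; rewrite {1}XE => -[s cs sx].
exists (h s), (spec (alg_gen iota [set` s])); split=> //.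
- exact: map_f.
- by apply: spec_zopen => // y sy; rewrite XE; exists s.
- by move=> Q [sQ dQ]; case: (hP s cs) => _; apply.
Qed.

End EnvelopesAndDiscrepancies.

Theorem theorem4p9 (R : realType) (K : fieldType)
  (iota : {rmorphism R[i] -> K}) (X Y : set (set K))
  (KX KY Delta : set K -> R)
  (hX : is_normal_variety iota X)
  (hY : is_normal_variety iota Y)
  (hf : projective_birational iota Y X)
  (hKX : canonical_divisor iota X KX)
  (hKY : canonical_divisor iota Y KY)
  (hpush : pushforward X KY = KX)
  (hDelta : is_divisor X Delta)
  (hDelta0 : effective Delta) :
  exists D T : set K -> R,
    [/\ is_divisor_sum Y (discrepancy iota X Y KX KY Delta) D,
        is_divisor_sum Y (env_coeff X (fun Q => - (KX Q + Delta Q))) T &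
        D = (fun P => KY P + T P)].
Proof.
have [[birYX _] [divKX _] [divKY _]] := And3 hf hKX hKY.
pose N Q := - (KX Q + Delta Q).
have divN : is_divisor X N.
  have [[finK KX0] [finD D0]] := (divKX, hDelta).
  have NE : [set Q | N Q != 0] `<=` [set Q | KX Q != 0] `|` [set Q | Delta Q != 0].
    move=> Q /= NQ; apply: contrapT => /not_orP[/negP/negPn/eqP h1 /negP/negPn/eqP h2].
    by move: NQ; rewrite /N h1 h2 addr0 oppr0 eqxx.
  split; first by apply: sub_finite_set NE _; rewrite finite_setU.
  by move=> Q /NE[/KX0|/D0].
have [hs [/allP hs0 hsP]] := variety_bounding_functions hX divN.
have main P : prime_divisor Y P -> exists c, [/\ env_coeff X N P = c%:E,
    discrepancy iota X Y KX KY Delta P = (KY P + c)%:E &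
    exists2 h, h \in hs & `|c| <= (ord P h)%:~R].
  move=> pP; have dP := prime_divisor_dvr hY pP; have [YP _] := pP.
  have [x Xx Px] := birYX _ YP; have [h [U [hhs oU Ux hU]]] := hsP _ Xx.
  have [ne ub bound] := slopes_bounds hX dP Px oU Ux (hs0 _ hhs) hU.
  exists (sup (slopes X x P N)); split; last by exists h.
    exact: (env_coeffE hX Xx dP Px).
  exact: (discrepancyE hX Xx dP Px).
(* [fine] loses nothing: by [main] the coefficient is finite along every prime divisor of [Y]. *)
pose T := patch (fun=> 0) (prime_divisor Y) (fun P => fine (env_coeff X N P)).
have TE P : prime_divisor Y P -> env_coeff X N P = (T P)%:E.
  move=> pP; have [c [cE _ _]] := main P pP.
  by rewrite /T /patch mem_set // cE.
have T0 P : ~ prime_divisor Y P -> T P = 0.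
  by move=> pP; rewrite /T /patch memNset.
have finT : finite_set [set P | T P != 0].
  apply: (@sub_finite_set _ _ (\bigcup_(h in [set` hs])
      [set P | prime_divisor Y P /\ ord P h != 0])); last first.
    by apply: bigcup_finite => [|h hhs]; [exact: finite_seq|exact: finite_div hY (hs0 _ hhs)].
  move=> P /= TP; have pP : prime_divisor Y P by apply: contrapT => /T0 /eqP; apply/negP.
  have [c [cE _ [h hhs hc]]] := main P pP; exists h => //; split=> //.
  have TPc : T P = c by apply: EFin_inj; rewrite -TE.
  by apply: contra_neq TP => ord0; apply/eqP; rewrite -normr_le0 TPc (le_trans hc) // ord0.
have [finKY KY0] := divKY.
exists (fun P => KY P + T P), T; split=> //; split.
- split; last first.
    move=> P /=; apply: contraPP => pP; rewrite (T0 _ pP) addr0.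
    by move/KY0.
  apply: (@sub_finite_set _ _ ([set P | KY P != 0] `|` [set P | T P != 0])).
    move=> P /= DP; apply: contrapT => /not_orP[/negP/negPn/eqP h1 /negP/negPn/eqP h2].
    by move: DP; rewrite h1 h2 addr0 eqxx.
  by rewrite finite_setU.
- move=> P pP; have [c [cE dE _]] := main P pP.
  by rewrite dE; congr (_%:E); congr (_ + _); apply: EFin_inj; rewrite -TE.
- by split=> // P /=; apply: contraPP => /T0 -> /eqP.
- exact: TE.
Qed.
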